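(* Let $D$ be a simple derivation of $\Bbbk[x_1,\dots,x_n]$ and let $\varphi\in\operatorname{Aut}(D)$. If $\varphi$ is algebraic, then $\varphi$ is unipotent. In particular, if $G\subset\operatorname{Aut}(D)$ is an algebraic subgroup, then $G$ is a unipotent subgroup, and therefore $G$ is a closed connected subgroup of $\operatorname{Aut}(D)^0$.
   Context: $\Bbbk$ is an algebraically closed field of characteristic $0$. A derivation $D$ of $\Bbbk[x_1,\dots,x_n]$ is a $\Bbbk$-linear endomorphism with $D(fg)=D(f)g+fD(g)$; it is simple if the only ideals $I$ with $D(I)\subset I$ are the trivial ones. $\operatorname{Aut}(D)$ is the group of $\Bbbk$-algebra automorphisms $\varphi$ of $\Bbbk[x_1,\dots,x_n]$ with $\varphi D=D\varphi$. $\operatorname{Aut}(\Bbbk[x_1,\dots,x_n])$ is canonically identified with $\operatorname{Aut}(\mathbb A^n)$ and is an ind-group, with filtration $\operatorname{Aut}(\Bbbk[x_1,\dots,x_n])_p=\{\varphi=(f_1,\dots,f_n): \deg f_i\le p\ \forall i\}$, where $f_i=\varphi(x_i)$; closures are taken in the inductive topology. $\operatorname{Aut}(D)$ is a closed subgroup, hence an ind-group; $\operatorname{Aut}(D)^0$ is its connected component containing the identity. A closed subgroup $G$ is algebraic if it is contained in some $\operatorname{Aut}(\Bbbk[x_1,\dots,x_n])_p$ (it is then an algebraic group acting regularly on $\mathbb A^n$). An automorphism $\varphi$ is algebraic if the closure $\overline{\langle\varphi\rangle}$ of the group it generates is an algebraic group; equivalently, $\varphi$ is locally finite as a linear endomorphism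 (every element lies in a finite-dimensional $\varphi$-stable subspace). An algebraic automorphism $\varphi$ is unipotent if it is locally unipotent, i.e. $\varphi-\mathrm{Id}$ is locally nilpotent as a linear endomorphism of $\Bbbk[x_1,\dots,x_n]$. *)

(* Defs.v *)
From HB Require Import structures.
From mathcomp Require Import all_boot all_order all_algebra.
From mathcomp Require Import boolp classical_sets topology.
(* The notations of mpoly clash with those of topology: below, [mpoly n k] is
   k[x_0, ..., x_{n-1}], [mpolyX k (mnm1 i)] is x_i, [mcoeff m f] is the
   coefficient of the monomial m in f, and [meval v P] is P evaluated at v. *)
From mathcomp Require Import -(notations) mpoly.

Set Implicit Arguments.
Unset Strict Implicit.
Unset Printing Implicit Defensive.

Import GRing.Theory.
Local Open Scope classical_set_scope.
Local Open Scope ring_scope.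

Section Derivations.
Variables (k : fieldType) (n : nat).

Definition derivation (D : mpoly n k -> mpoly n k) : Prop :=
  linear D /\ forall f g, D (f * g) = D f * g + f * D g.

(* Unlike [idealr_closed], the unit ideal is allowed. *)
Definition ideal (I : set (mpoly n k)) : Prop :=
  [/\ I 0, forall f g, I f -> I g -> I (f + g)
    & forall a f, I f -> I (a * f)].

Definition simple_derivation (D : mpoly n k -> mpoly n k) : Prop :=
  derivation D /\
  forall I, ideal I -> D @` I `<=` I -> I = [set 0] \/ I = setT.

End Derivations.

Definition is_alg_aut (k : fieldType) (n : nat)
    (f : mpoly n k -> mpoly n k) : Prop :=
  [/\ linear f, GRing.monoid_morphism f & bijective f].

Record polyAut (k : fieldType) (n : nat) := PolyAut {
  polyAut_val :> mpoly n k -> mpoly n k;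
  polyAutP : is_alg_aut polyAut_val
}.

HB.instance Definition _ (k : fieldType) (n : nat) :=
  gen_eqMixin (polyAut k n).
HB.instance Definition _ (k : fieldType) (n : nat) :=
  gen_choiceMixin (polyAut k n).

Section Group.
Variables (k : fieldType) (n : nat).
Implicit Types phi psi : polyAut k n.

Lemma polyAut_ext phi psi : phi =1 psi -> phi = psi.
Proof.
case: phi psi => [f Hf] [g Hg] /= /funext fg; case: _ / fg in Hg *.
by congr PolyAut; exact: Prop_irrelevance.
Qed.

Lemma is_alg_aut_id : is_alg_aut (@id (mpoly n k)).
Proof. by split=> //; exists id. Qed.

Lemma is_alg_aut_comp phi psi : is_alg_aut (phi \o psi).
Proof.
have [lf [f1 fM] bf] := polyAutP phi; have [lg [g1 gM] bg] := polyAutP psi.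
split; last exact: bij_comp.
- by move=> a u v /=; rewrite lg lf.
- by split=> [|u v] /=; rewrite ?g1 ?f1 // gM fM.
Qed.

Lemma polyAut_surj phi g : exists f, phi f == g.
Proof. by have [_ _ [h hK Kh]] := polyAutP phi; exists (h g); rewrite Kh. Qed.

Definition polyAut_inv_fun phi g := xchoose (polyAut_surj phi g).

Lemma polyAut_invK phi : cancel (polyAut_inv_fun phi) phi.
Proof. by move=> g; exact/eqP/(xchooseP (polyAut_surj phi g)). Qed.

Lemma polyAutK phi : cancel phi (polyAut_inv_fun phi).
Proof.
have [_ _ bf] := polyAutP phi.
by move=> g; apply: (bij_inj bf); rewrite polyAut_invK.
Qed.

Lemma is_alg_aut_inv phi : is_alg_aut (polyAut_inv_fun phi).
Proof.
have [lf [f1 fM] bf] := polyAutP phi; have fI := bij_inj bf.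
split.
- by move=> a u v; apply: fI; rewrite lf !polyAut_invK.
- by split=> [|u v]; apply: fI; rewrite ?fM !polyAut_invK ?f1.
- by exists phi; [exact: polyAut_invK | exact: polyAutK].
Qed.

Definition polyAut_one := PolyAut is_alg_aut_id.
Definition polyAut_mul phi psi := PolyAut (is_alg_aut_comp phi psi).
Definition polyAut_inv phi := PolyAut (is_alg_aut_inv phi).

Lemma polyAut_mulA : associative polyAut_mul.
Proof. by move=> phi psi chi; exact: polyAut_ext. Qed.

Lemma polyAut_mul1 : left_id polyAut_one polyAut_mul.
Proof. by move=> phi; exact: polyAut_ext. Qed.

Lemma polyAut_1mul : right_id polyAut_one polyAut_mul.
Proof. by move=> phi; exact: polyAut_ext. Qed.

Lemma polyAut_mulVl : left_inverse polyAut_one polyAut_inv polyAut_mul.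
Proof. by move=> phi; apply: polyAut_ext => f /=; exact: polyAutK. Qed.

Lemma polyAut_mulVr : right_inverse polyAut_one polyAut_inv polyAut_mul.
Proof. by move=> phi; apply: polyAut_ext => f /=; exact: polyAut_invK. Qed.

HB.instance Definition _ := isGroup.Build (polyAut k n)
  polyAut_mulA polyAut_mul1 polyAut_1mul polyAut_mulVl polyAut_mulVr.

End Group.

Section IndTopology.
Variables (k : fieldType) (n : nat).
Implicit Types (p : nat) (A B : set (polyAut k n)).

(* [msize] is the degree plus one, and [msize 0 = 0]. *)
Definition Aut_le p : set (polyAut k n) :=
  [set phi : polyAut k n | forall i, (msize (phi (mpolyX k (mnm1 i))) <= p.+1)%N].

(* The coefficients (i, m), with m a monomial of degree at most p, are the
   coordinates of the affine space of n-tuples of polynomials of degree at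
   most p; [coords p phi] is the point (phi x_0, ..., phi x_{n-1}) of it. *)
Definition coord p : finType := ('I_n * bmultinom n p.+1)%type.

Definition coords p (phi : polyAut k n) (j : 'I_#|coord p|) : k :=
  let: (i, m) := enum_val j in mcoeff m (phi (mpolyX k (mnm1 i))).

Definition zariski_closed_le p A : Prop :=
  exists S : set (mpoly #|coord p| k),
    A = Aut_le p `&`
        [set phi : polyAut k n | forall P, S P -> meval (@coords p phi) P = 0].

(* [A] is closed iff its trace on each piece of the filtration is Zariski
   closed there, each piece having the topology induced by affine space. *)
Definition ind_closed A : Prop := forall p, zariski_closed_le p (A `&` Aut_le p).
Definition ind_open A : Prop := ind_closed (~` A).

Lemma ind_openT : ind_open setT.
Proof.
move=> p; exists setT; rewrite setCT set0I; apply/esym.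
rewrite -subset0 => phi /= [_ /(_ 1 I)].
by rewrite meval1 => /eqP; rewrite oner_eq0.
Qed.

Lemma ind_openI : setI_closed ind_open.
Proof.
move=> A B oA oB p; rewrite setCI setIUl.
have [S ->] := oA p; have [T ->] := oB p.
exists [set P | exists2 Q, S Q & exists2 R, T R & P = Q * R].
apply/seteqP; split=> phi /=.
- case=> -[phip H]; split=> // _ [Q SQ [R TR ->]]; rewrite mevalM.
    by rewrite (H _ SQ) mul0r.
  by rewrite (H _ TR) mulr0.
- move=> [phip H].
  have [HS|/existsNP[Q /not_implyP[SQ /eqP Q0]]] :=
    pselect (forall P, S P -> meval (coords phi) P = 0); first by left.
  right; split=> // R TR; have /eqP := H _ (ex_intro2 _ _ Q SQ
    (ex_intro2 _ _ R TR (erefl _))).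
  by rewrite mevalM mulf_eq0 (negbTE Q0) => /eqP.
Qed.

Lemma ind_open_bigU (I : Type) (U : I -> set (polyAut k n)) :
  (forall i, ind_open (U i)) -> ind_open (\bigcup_i U i).
Proof.
move=> oU p; rewrite setC_bigcup.
exists [set P | forall phi, (\bigcap_i ~` U i) phi -> Aut_le p phi ->
                  meval (@coords p phi) P = 0].
apply/seteqP; split=> phi /=.
- by move=> [Uphi phip]; split=> // P; apply.
- move=> [phip H]; split=> // i _; have [S /seteqP[sub sup]] := oU i p.
  suff: (~` U i `&` Aut_le p) phi by case.
  apply: sup; split=> // P SP; apply: H => psi Upsi psip.
  have /sub[_] : (~` U i `&` Aut_le p) psi by split=> //; exact: Upsi.
  exact.
Qed.

HB.instance Definition _ := isOpenTopological.Build (polyAut k n)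
  ind_openT ind_openI ind_open_bigU.

Lemma closedE A : closed A <-> ind_closed A.
Proof.
rewrite -[A in X in _ <-> X]setCK -/(ind_open (~` A)).
split=> [/closed_openC //|/(@open_closedC (polyAut k n))].
by rewrite setCK.
Qed.

End IndTopology.

Section Subgroups.
Variables (k : fieldType) (n : nat).
Implicit Types (phi : polyAut k n) (G H : set (polyAut k n)).

Definition subgroup G : Prop := group_closed [in G].

Definition generated phi : set (polyAut k n) := smallest subgroup [set phi].

Definition algebraic_subgroup G : Prop :=
  [/\ subgroup G, closed G & exists p, G `<=` Aut_le p].

Definition algebraic phi : Prop := algebraic_subgroup (closure (generated phi)).

(* [phi - Id] is locally nilpotent. *)
Definition locally_unipotent phi : Prop :=
  forall f, exists m, iter m (fun g => phi g - g) f = 0.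

Definition unipotent phi : Prop := algebraic phi /\ locally_unipotent phi.

Definition unipotent_subgroup G : Prop :=
  algebraic_subgroup G /\ G `<=` unipotent.

Definition AutD (D : mpoly n k -> mpoly n k) : set (polyAut k n) :=
  [set phi : polyAut k n | phi \o D = D \o phi].

Definition AutD0 (D : mpoly n k -> mpoly n k) : set (polyAut k n) :=
  connected_component (AutD D) 1%g.

(* [G] is closed for the topology induced on [H]. *)
Definition closed_connected_subgroup_of G H : Prop :=
  [/\ subgroup G, G `<=` H, exists2 C, closed C & G = C `&` H & connected G].

End Subgroups.

(* Main.v *)
(* A semisimple algebraic automorphism commuting with D would yield, after
   composing the eigenvalue grading of k[x] with a character of prime order r of
   the finitely generated group of eigenvalues, an endomorphism s <> id of order
   r commuting with D.  The ideal generated by the s f - f is D-stable, hence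
   contains 1, so s acts on affine space without fixed points.  This is
   impossible by an argument of Serre: the finitely many coefficients involved
   specialize to a finite field F with r <> 0 in F, and a permutation of order r
   of F^n has a fixed point since r does not divide #|F|^n.  Hence 1 is the only
   eigenvalue, i.e. phi is locally unipotent.
   A unipotent phi lies on the one-parameter group t |-> phi^t, where
   phi^t f = sum_j binom(t, j) (phi - 1)^j f is polynomial in t.  As phi^m is in
   a closed subgroup for all natural m, so is phi^t for all t; this gives
   connectedness, and identifies the closure of the group generated by phi. *)
Require Import Defs.
From HB Require Import structures.
From mathcomp Require Import all_boot all_order all_algebra all_fingroup.
From mathcomp Require Import all_solvable all_field ring.
From mathcomp Require Import boolp classical_sets topology.
From mathcomp Require Import -(notations) mpoly.

Set Implicit Arguments.
Unset Strict Implicit.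
Unset Printing Implicit Defensive.

Import GRing.Theory.
Local Open Scope ring_scope.

(** * Specialization to finite fields *)

Lemma finField_root (F : finFieldType) (p : {poly F}) : (1 < size p)%N ->
  exists (F' : finFieldType) (i : {rmorphism F -> F'}) (x : F'),
    root (map_poly i p) x.
Proof.
move=> p_gt1; have p0 : p != 0 by rewrite -size_poly_gt0 ltnW.
have [L [zs Dp _]] := FinSplittingFieldFor p0.
case: zs Dp => [|z zs] Dp.
  have := eqp_size Dp; rewrite big_nil size_poly1 size_map_poly => sp.
  by rewrite sp in p_gt1.
exists (FinFieldExtType L), (in_alg L), z.
have := eqp_root Dp z; rewrite big_cons rootM root_XsubC eqxx /=.
by [].
Qed.

(** The subring meant is the image [e B] of [k], and [t] induces a morphism from it to a finite
    field that does not kill [e s]. Keeping [B] and [e] apart lets an element be adjoined by passing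
    from [B] to [{poly B}], without forming a quotient. *)
Definition specializable (B : comNzRingType) (k : fieldType)
    (e : {rmorphism B -> k}) : Prop :=
  forall s, e s != 0 -> exists (F : finFieldType) (t : {rmorphism B -> F}),
    (forall x, e x = 0 -> t x = 0) /\ t s != 0.

(** In characteristic 0 the integers embed in [k], and reduction modulo a prime larger than [|s|]
    keeps [s] nonzero. *)
Lemma specializable_int (k : fieldType) : [pchar k] =i pred0 ->
  specializable (intmul (1 : k)).
Proof.
move=> k0 s s0.
have [p ltsp p_pr] := prime_above `|s|.
have sN0 : `|s|%N != 0%N.
  by apply: contraNneq s0 => /eqP; rewrite absz_eq0 => /eqP ->.
exists 'F_p, (intmul (1 : 'F_p)); split=> [x|].
  have : (x%:~R == 0 :> k) = (x == 0).
    by case: x => m; rewrite ?NegzE ?rmorphN ?oppr_eq0 /= -pmulrn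
      ((pcharf0P k).1 k0).
  by move=> E /eqP; rewrite E => /eqP ->.
have : (`|s|%:R : 'F_p) != 0.
  rewrite -(dvdn_pcharf (pchar_Fp p_pr)); apply: contraL ltsp => /dvdn_leq.
  by rewrite -leqNgt lt0n; apply.
case: (s) => m //=; rewrite NegzE rmorphN oppr_eq0 //=.
Qed.

(** [M] is an ideal of [B[X]] containing the kernel of [map_poly e]. An element [h] of least size
    with nonzero image generates its image up to powers of the leading coefficient, by
    pseudo-division; this replaces division over the fraction field of [e B]. *)
Lemma min_pseudo_div (B : comNzRingType) (k : fieldType)
    (e : {rmorphism B -> k}) (M : {poly B} -> Prop) :
  (forall p q, M p -> M q -> M (p - q)) -> (forall a p, M p -> M (a * p)) ->
  (forall p, map_poly e p = 0 -> M p) ->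
  (exists2 h, M h & map_poly e h != 0) ->
  exists h, [/\ M h, e (lead_coef h) != 0,
    forall p, M p -> exists m q,
      e (lead_coef h) ^+ m *: map_poly e p = map_poly e q * map_poly e h
    & forall p, M p -> map_poly e p != 0 ->
      (size (map_poly e h) <= size (map_poly e p))%N].
Proof.
move=> MB MM Mker [h0 Mh0 h0n0].
pose P n := `[< exists h, [/\ M h, map_poly e h != 0 & size h = n] >].
have exP : exists n, P n by exists (size h0); apply/asboolP; exists h0.
case: (ex_minnP exP) => n /asboolP[h [Mh hn0 sh]] minh.
have trunc p : M p -> map_poly e p != 0 ->
    (size h <= size (map_poly e p))%N.
  (* Cutting [p] down to the size of its image changes it by an element of the kernel, hence stays
     in [M]. So minimality among lifts also bounds sizes of images, and the leading coefficient of
     [h] survives under [e]. *)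
  move=> Mp pn0; pose p' := \poly_(i < size (map_poly e p)) p`_i.
  have ep' : map_poly e p' = map_poly e p.
    apply/polyP=> i; rewrite coef_map coef_poly.
    case: ltnP => [|lepi]; first by rewrite coef_map.
    by rewrite (nth_default _ lepi); exact: rmorph0.
  apply: leq_trans (size_poly _ (fun i => p`_i)); rewrite sh; apply: minh.
  apply/asboolP; exists p'; rewrite ep'; split=> //.
  rewrite -[p'](subKr p); apply: (MB _ _ Mp); apply: Mker.
  by rewrite rmorphB /= ep' subrr.
have sheq : size (map_poly e h) = size h.
  by apply/eqP; rewrite eqn_leq size_poly trunc.
have lh0 : e (lead_coef h) != 0.
  by move: hn0; rewrite -lead_coef_eq0 lead_coefE sheq coef_map.
exists h; split=> // [p Mp|p Mp pn0]; last by rewrite sheq trunc.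
exists (Pdiv.Ring.rscalp p h), (Pdiv.Ring.rdivp p h).
have E := Pdiv.ComRing.rdivp_eq h p.
suff R0 : map_poly e (Pdiv.Ring.rmodp p h) = 0.
  move/(congr1 (map_poly e)): E.
  by rewrite map_polyZ rmorphD rmorphM /= R0 addr0 rmorphXn.
apply/eqP; apply: contraT => Rn0.
have MR : M (Pdiv.Ring.rmodp p h).
  have -> : Pdiv.Ring.rmodp p h = (lead_coef h ^+ Pdiv.Ring.rscalp p h)%:P * p
      - Pdiv.Ring.rdivp p h * h.
    by rewrite mul_polyC E [_ + Pdiv.Ring.rmodp p h]addrC addrK.
  by apply: MB; apply: MM.
have := trunc _ MR Rn0; rewrite leqNgt => /negP[].
apply: leq_ltn_trans (size_poly _ _) _.
rewrite Pdiv.Ring.ltn_rmodp; apply: contraNneq hn0 => ->.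
by rewrite rmorph0.
Qed.

Lemma horner_map_ker (B : comNzRingType) (k : fieldType) (F : finFieldType)
    (e : {rmorphism B -> k}) (t : {rmorphism B -> F}) :
  (forall x, e x = 0 -> t x = 0) ->
  forall p, map_poly e p = 0 -> map_poly t p = 0.
Proof.
move=> ker p p0; apply/polyP=> i; rewrite coef_map coef0; apply: ker.
by rewrite -coef_map p0 coef0.
Qed.

(** * Adjoining one element of the field to a specializable subring *)

Section Adjunction.
Variables (B : comNzRingType) (k : fieldType) (e : {rmorphism B -> k}) (c : k).
Hypothesis spec : specializable e.

Lemma specialize_transcendental (s : {poly B}) :
  (forall p, (map_poly e p).[c] = 0 -> map_poly e p = 0) ->
  (map_poly e s).[c] != 0 ->
  exists (F : finFieldType) (t : {rmorphism B -> F}) (x : F),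
    (forall p, (map_poly e p).[c] = 0 -> (map_poly t p).[x] = 0) /\
    (map_poly t s).[x] != 0.
Proof.
move=> trc sc0.
have : lead_coef (map_poly e s) != 0.
  by rewrite lead_coef_eq0; apply: contraNneq sc0 => ->; rewrite horner0.
rewrite lead_coefE coef_map => /spec[F [t [ker ts0]]].
have tsn0 : map_poly t s != 0.
  by apply: contraNneq ts0 => E; rewrite -coef_map E coef0.
(* The polynomial [map_poly t s] may vanish on all of [F]. A root [x] of [s X - 1] in an extension
   satisfies [s(x) x = 1], so [s(x)] is nonzero. *)
have [|F' [i [x]]] := @finField_root F (map_poly t s * 'X - 1).
  by rewrite size_polyDl size_mulX // ?size_polyN ?size_poly1 ltnS size_poly_gt0.
rewrite rmorphB rmorphM /= map_polyX rmorph1 rootE !hornerE subr_eq0 => /eqP E.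
exists F', (i \o t), x; split=> [p /trc/(horner_map_ker ker) p0|].
  by rewrite map_poly_comp p0 rmorph0 horner0.
rewrite map_poly_comp; apply/eqP => E0; move/eqP: E.
by rewrite E0 mul0r eq_sym oner_eq0.
Qed.

(** Up to leading coefficients, [g] is the minimal polynomial of [c] and [h] is a gcd of [g] and
    [s], which is constant since [s(c)] is nonzero. Once both leading coefficients survive in a
    finite field, any root of the image of [g] can serve as the image of [c]. *)
Lemma specialize_algebraic (s : {poly B}) :
  (exists2 p, (map_poly e p).[c] = 0 & map_poly e p != 0) ->
  (map_poly e s).[c] != 0 ->
  exists (F : finFieldType) (t : {rmorphism B -> F}) (x : F),
    (forall p, (map_poly e p).[c] = 0 -> (map_poly t p).[x] = 0) /\
    (map_poly t s).[x] != 0.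
Proof.
move=> alg sc0.
have [|||g [gc0 lg0 divg ming]] := @min_pseudo_div B k e
    (fun p => (map_poly e p).[c] = 0) _ _ _ alg.
- by move=> p q p0 q0; rewrite rmorphB !hornerE p0 q0 subr0.
- by move=> a p p0; rewrite rmorphM !hornerE p0 mulr0.
- by move=> p ->; rewrite horner0.
have gn0 : map_poly e g != 0.
  by apply: contraNneq lg0 => E; rewrite lead_coefE -coef_map E coef0.
pose M p := exists u v, map_poly e p =
  map_poly e u * map_poly e s + map_poly e v * map_poly e g.
have Mg : M g by exists 0, 1; rewrite rmorph0 rmorph1 mul0r mul1r add0r.
have Ms : M s by exists 1, 0; rewrite rmorph0 rmorph1 mul0r mul1r addr0.
have [||||h [[u [v hE]] lh0 divh _]] := @min_pseudo_div B k e M.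
- move=> p q [u [v pE]] [u' [v' qE]]; exists (u - u'), (v - v').
  by rewrite !rmorphB /= pE qE !mulrBl addrACA opprD.
- move=> a p [u [v pE]]; exists (a * u), (a * v).
  by rewrite !rmorphM /= pE mulrDr !mulrA.
- by move=> p p0; exists 0, 0; rewrite p0 !rmorph0 !mul0r addr0.
- by exists g.
have hn0 : map_poly e h != 0.
  by apply: contraNneq lh0 => E; rewrite lead_coefE -coef_map E coef0.
have hc0 : (map_poly e h).[c] != 0.
  have [m [q /(congr1 (horner^~ c))]] := divh _ Ms.
  rewrite !hornerE => E; apply: contraTneq (oner_neq0 k) => hc0.
  by move/eqP: E; rewrite hc0 mulr0 mulf_eq0 expf_eq0 (negPf lh0) andbF (negPf sc0).
(* Up to a scalar [g = q h] over [k]. As [h(c)] is nonzero, [q] vanishes at [c], so [q] is at least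
   as large as the minimal [g], which leaves [h] constant. *)
have sh1 : size (map_poly e h) = 1%N.
  have [m [q E]] := divh _ Mg.
  have lhm : e (lead_coef h) ^+ m != 0 by rewrite expf_eq0 (negPf lh0) andbF.
  have qn0 : map_poly e q != 0.
    apply: contraNneq gn0 => q0; move/eqP: E; rewrite q0 mul0r.
    by rewrite scaler_eq0 (negPf lhm).
  have qc0 : (map_poly e q).[c] = 0.
    move/(congr1 (horner^~ c)): E; rewrite !hornerE gc0 mulr0 => /esym/eqP.
    by rewrite mulf_eq0 (negPf hc0) orbF => /eqP.
  have := ming _ qc0 qn0; rewrite -(size_scale (map_poly e g) lhm) E size_mul //.
  move: hn0 qn0; rewrite -!size_poly_gt0.
  case: (size (map_poly e h)) => // a _; case: (size (map_poly e q)) => // b _.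
  by rewrite addnS /= -[leqRHS]addn0 leq_add2l leqn0 => /eqP ->.
have [|F [t [ker]]] := spec (s := lead_coef g * lead_coef h).
  by rewrite rmorphM mulf_neq0.
rewrite rmorphM mulf_eq0 negb_or => /andP[tg th].
have sg : (1 < size (map_poly t g))%N.
  rewrite ltnNge; apply/negP => le1.
  have sg1 : (size g <= 1)%N.
    rewrite leqNgt; apply/negP => lt1; have := leq_sizeP _ _ le1 (size g).-1.
    rewrite coef_map => E; move: tg; rewrite lead_coefE E ?eqxx //.
    by case: (size g) lt1.
  move: gc0 lg0; rewrite (size1_polyC sg1) map_polyC hornerC lead_coefC => ->.
  by rewrite eqxx.
have sh : (size h <= 1)%N by rewrite -(size_map_poly_id0 lh0) sh1.
have [F' [i [x /eqP gx0]]] := finField_root sg.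
pose t' : {rmorphism B -> F'} := i \o t.
have ker' y : e y = 0 -> t' y = 0 by move=> /ker ty0 /=; rewrite ty0 rmorph0.
have lead0 y : t y != 0 -> t' y != 0 by rewrite fmorph_eq0.
have gx : (map_poly t' g).[x] = 0 by rewrite map_poly_comp.
(* If [p] vanishes at [c], a power of the leading coefficient of [g] times [p] is a multiple of [g]
   modulo the kernel, hence vanishes at [x]. For [s], the relation [h = u s + v g] at [x] reduces to
   [h = u(x) s(x)], with [h] nonzero. *)
exists F', t', x; split=> [p /divg[m [q E]]|].
  have /(horner_map_ker ker') : map_poly e (lead_coef g ^+ m *: p - q * g) = 0.
    by rewrite rmorphB rmorphM /= map_polyZ rmorphXn E subrr.
  rewrite rmorphB rmorphM /= map_polyZ rmorphXn => /(congr1 (horner^~ x)).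
  rewrite !hornerE gx mulr0 subr0 => /eqP.
  by rewrite mulf_eq0 expf_eq0 (negPf (lead0 _ tg)) andbF => /eqP.
move: hE; rewrite (size1_polyC sh) => hE.
have /(horner_map_ker ker') : map_poly e ((h`_0)%:P - (u * s + v * g)) = 0.
  by rewrite rmorphB rmorphD !rmorphM /= hE subrr.
rewrite rmorphB rmorphD !rmorphM /= map_polyC => /(congr1 (horner^~ x)).
rewrite !hornerE gx mulr0 addr0 => /eqP; rewrite subr_eq0 => /eqP E.
have := lead0 _ th; rewrite (size1_polyC sh) lead_coefC E.
by rewrite mulf_eq0 negb_or => /andP[].
Qed.

Lemma specializable_poly :
  specializable (horner_morph (fun x => mulrC c (e x)) : {rmorphism {poly B} -> k}).
Proof.
move=> s sc0.
suff [F [t [x [ker ts0]]]] :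
    exists (F : finFieldType) (t : {rmorphism B -> F}) (x : F),
    (forall p, (map_poly e p).[c] = 0 -> (map_poly t p).[x] = 0) /\
    (map_poly t s).[x] != 0.
  by exists F, (horner_morph (fun y => mulrC x (t y))).
have [alg|nalg] := pselect (exists2 p, (map_poly e p).[c] = 0 & map_poly e p != 0).
  exact: specialize_algebraic.
apply: specialize_transcendental => // p p0.
by apply/eqP; apply: contra_notT nalg => ?; exists p.
Qed.

End Adjunction.

Lemma specializable_seq (k : fieldType) : [pchar k] =i pred0 -> forall cs : seq k,
  exists (B : comNzRingType) (e : {rmorphism B -> k}),
    specializable e /\ forall c, c \in cs -> exists b, e b = c.
Proof.
move=> k0; elim=> [|c cs [B [e [spec lift]]]].
  by exists int, (intmul (1 : k)); split=> //; exact: specializable_int.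
exists {poly B}, (horner_morph (fun x => mulrC c (e x))); split.
  exact: specializable_poly.
move=> d; rewrite inE => /predU1P[->|/lift[b <-]].
  by exists 'X; exact: horner_morphX.
by exists b%:P; exact: horner_morphC.
Qed.

(** * Endomorphisms of prime order have fixed points *)

Section LinearFunctions.
Variables (k : fieldType) (U V : lmodType k) (f : U -> V).
Hypothesis lf : linear f.

Lemma linear_add u v : f (u + v) = f u + f v.
Proof. by rewrite -[u]scale1r lf !scale1r. Qed.

Lemma linear_zero : f 0 = 0.
Proof. by apply: (addIr (f 0)); rewrite -linear_add !add0r. Qed.

Lemma linear_scale a u : f (a *: u) = a *: f u.
Proof. by rewrite -[a *: u]addr0 lf linear_zero addr0. Qed.

Lemma linear_sub u v : f (u - v) = f u - f v.
Proof. by rewrite linear_add -scaleN1r linear_scale scaleN1r. Qed.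

Lemma linear_bigsum (I : Type) (s : seq I) (P : pred I) (F : I -> U) :
  f (\sum_(i <- s | P i) F i) = \sum_(i <- s | P i) f (F i).
Proof. exact: (big_morph f linear_add linear_zero). Qed.

End LinearFunctions.

Lemma mpoly_alg_ind (R : comNzRingType) n (P : mpoly n R -> Prop) :
  (forall c, P (mpolyC n c)) -> (forall i, P (mpolyX R (mnm1 i))) ->
  (forall f g, P f -> P g -> P (f + g)) ->
  (forall f g, P f -> P g -> P (f * g)) -> forall f, P f.
Proof.
move=> PC PX PD PM f.
have P1 : P 1 by rewrite -(mpolyC1 n R).
elim/mpolyind: f => [|c m f _ _ Pf]; first by rewrite -mpolyC0.
apply: PD => //; rewrite -mul_mpolyC; apply: (PM) => //; rewrite mpolyXE_id.
apply: (big_ind P P1 PM) => i _; elim: (m i) => [|d IH]; first by rewrite expr0.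
by rewrite exprS; apply: PM.
Qed.

Lemma map_mpoly_subst (R S : comNzRingType) (t : {rmorphism R -> S}) n
    (lq : n.-tuple (mpoly n R)) p :
  map_mpoly t (comp_mpoly lq p) =
  comp_mpoly (map_tuple (map_mpoly t) lq) (map_mpoly t p).
Proof.
elim/mpoly_alg_ind: p => [c|i|f g Hf Hg|f g Hf Hg].
- by rewrite comp_mpolyC !map_mpolyC comp_mpolyC.
- by rewrite map_mpolyX !comp_mpolyXU (nth_map 0) // size_tuple.
- by rewrite !rmorphD /= Hf Hg.
- by rewrite !rmorphM /= Hf Hg.
Qed.

Lemma alg_endo_subst (k : fieldType) n (s : mpoly n k -> mpoly n k) :
  linear s -> GRing.monoid_morphism s ->
  forall f, s f = comp_mpoly [tuple s (mpolyX k (mnm1 i)) | i < n] f.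
Proof.
move=> ls [s1 sM] f.
elim/mpoly_alg_ind: f => [c|i|f g Hf Hg|f g Hf Hg].
- by rewrite comp_mpolyC -[c]mulr1 -alg_mpolyC mulr1 (linear_scale ls) s1.
- by rewrite comp_mpolyXU -tnth_nth tnth_mktuple.
- by rewrite (linear_add ls) rmorphD /= Hf Hg.
- by rewrite sM rmorphM /= Hf Hg.
Qed.

Lemma map_mpoly_ker (R : comNzRingType) (k F : fieldType) n
    (e : {rmorphism R -> k}) (t : {rmorphism R -> F}) :
  (forall x, e x = 0 -> t x = 0) -> forall p q : mpoly n R,
  map_mpoly e p = map_mpoly e q -> map_mpoly t p = map_mpoly t q.
Proof.
move=> ker p q epq; apply/eqP; rewrite -subr_eq0 -rmorphB; apply/eqP.
apply/mpolyP=> m; rewrite mcoeff_map_mpoly mcoeff0; apply: ker.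
by rewrite -mcoeff_map_mpoly rmorphB /= epq subrr mcoeff0.
Qed.

Lemma lift_mpoly (R : comNzRingType) (k : fieldType) n (e : {rmorphism R -> k})
    (p : mpoly n k) :
  (forall m, m \in msupp p -> exists b, e b = mcoeff m p) ->
  exists q, map_mpoly e q = p.
Proof.
move=> lift.
suff [q qE] : exists q, map_mpoly e q =
    \sum_(m <- msupp p) mcoeff m p *: mpolyX k m by exists q; rewrite qE -mpolyE.
elim: (msupp p) lift => [|m ms IH] lift.
  by exists 0; rewrite big_nil rmorph0.
have [|q qE] := IH; first by move=> m' m'ms; apply: lift; rewrite inE m'ms orbT.
have [|b bE] := lift m; first by rewrite inE eqxx.
exists (b *: mpolyX R m + q).
by rewrite big_cons -qE -bE rmorphD /= map_mpolyZ map_mpolyX.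
Qed.

(** By Cauchy's theorem the additive group would otherwise contain [x] of order [r], and [r x = 0]
    forces [x = 0]. *)
Lemma prime_dvd_card_finField (F : finFieldType) r : prime r ->
  (r%:R : F) != 0 -> ~~ (r %| #|F|)%N.
Proof.
move=> pr_r r0; apply/negP; rewrite -cardsT.
move=> /(Cauchy (G := [set: F]%G) pr_r)[x _ xr].
have /eqP : (x ^+ r)%g == 1%g by rewrite -order_dvdn xr.
rewrite FinRing.zmodXgE -mulr_natr => /eqP; rewrite mulf_eq0 (negPf r0) orbF.
by move/eqP=> x0; move: xr pr_r; rewrite x0 order1 => <-.
Qed.

(** The cyclic group generated by [act] is an [r]-group, so its number of fixed points is congruent
    to [#|T|] modulo [r]. *)
Lemma prime_order_fixed_point (T : finType) (act : T -> T) r :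
  prime r -> (forall v, iter r act v = v) -> ~~ (r %| #|T|)%N ->
  exists v, act v = v.
Proof.
move=> pr_r actr ndvd.
have act_inj : injective act.
  apply: (can_inj (g := iter r.-1 act)) => v.
  by rewrite -iterSr prednK ?prime_gt0.
pose s := perm act_inj.
have rG : (r.-group <[s]>)%g.
  apply: (@pnat_dvd _ r); last by rewrite pnat_id.
  rewrite [#|_|]orderE order_dvdn; apply/eqP/permP=> v; rewrite permX perm1.
  by rewrite -[RHS]actr; apply: eq_iter => x; rewrite permE.
have aT : [acts <[s]>, on [set: T] | 'P]%g.
  by apply/actsP=> a _ x; rewrite !inE.
have := pgroup_fix_mod rG aT.
have [E|[v]] := set_0Vmem ('Fix_([set: T] | 'P)(<[s]>))%g.
  by rewrite E cards0 cardsT mod0n => /eqP; rewrite -/(dvdn _ _) (negPf ndvd).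
rewrite inE afix_cycle => /andP[_ /afix1P sv] _; exists v.
by rewrite -[RHS]sv /= /aperm permE.
Qed.

(** The relation is transported to a finite field, where [s] acts on points and has a fixed point.
    Evaluating there makes every [s f - f] vanish, so the relation becomes [0 = 1]. *)
Lemma prime_order_fixed_ideal (k : fieldType) (k0 : [pchar k] =i pred0) n
    (s : mpoly n k -> mpoly n k) r (w : seq (mpoly n k * mpoly n k)) :
  prime r -> linear s -> GRing.monoid_morphism s -> iter r s =1 id ->
  \sum_(af <- w) af.1 * (s af.2 - af.2) <> 1.
Proof.
move=> pr_r ls sM sr w1.
pose qs := codom (fun i => s (mpolyX k (mnm1 i))) ++ unzip1 w ++ unzip2 w.
have [B [e [spec lift]]] :=
  specializable_seq k0 (flatten [seq [seq mcoeff m q | m <- msupp q] | q <- qs]).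
have {}lift q : q \in qs -> exists p, map_mpoly e p = q.
  move=> qqs; apply: lift_mpoly => m mq; apply: lift; apply/flattenP.
  exists [seq mcoeff m q | m <- msupp q]; last exact: map_f.
  exact: (map_f (fun q => [seq mcoeff m q | m <- msupp q])).
have [|F [t [ker tr]]] := spec r%:R.
  by rewrite rmorph_nat ((pcharf0P k).1 k0) -lt0n prime_gt0.
rewrite rmorph_nat in tr.
have /choice[lx lxE] : forall i, exists p, map_mpoly e p = s (mpolyX k (mnm1 i)).
  by move=> i; apply: lift; rewrite mem_cat codom_f.
pose lq := [tuple lx i | i < n].
have es p : map_mpoly e (comp_mpoly lq p) = s (map_mpoly e p).
  rewrite (alg_endo_subst ls sM) map_mpoly_subst; congr comp_mpoly.
  by apply: eq_from_tnth => i; rewrite tnth_map !tnth_mktuple.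
have esi m p : map_mpoly e (iter m (comp_mpoly lq) p) = iter m s (map_mpoly e p).
  by elim: m => //= m <-.
pose act (v : {ffun 'I_n -> F}) :=
  [ffun i => meval v (map_mpoly t (lx i))] : {ffun 'I_n -> F}.
have evs (v : {ffun 'I_n -> F}) p :
    meval v (map_mpoly t (comp_mpoly lq p)) = meval (act v) (map_mpoly t p).
  rewrite map_mpoly_subst comp_mpoly_meval; apply: meval_eq => i.
  by rewrite tnth_map tnth_mktuple ffunE.
have evsi m (v : {ffun 'I_n -> F}) p :
    meval v (map_mpoly t (iter m (comp_mpoly lq) p)) =
    meval (iter m act v) (map_mpoly t p).
  by elim: m v => //= m IH v; rewrite evs IH -iterSr.
(* The lift [lq] of [s] has order dividing [r] only modulo the kernel of [e], but [t] kills that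
   kernel, so the identity does hold on points over [F]. *)
have actr v : iter r act v = v.
  apply/ffunP=> i; have := evsi r v (mpolyX B (mnm1 i)).
  rewrite (@map_mpoly_ker _ _ _ _ _ _ ker _ (mpolyX B (mnm1 i))).
    by rewrite !map_mpolyX !mevalXU.
  by rewrite esi sr.
have [|v fix_v] := prime_order_fixed_point pr_r actr.
  rewrite card_ffun Euclid_dvdX // negb_and.
  by rewrite prime_dvd_card_finField.
have [w' w'E] : exists w' : seq (mpoly n B * mpoly n B),
    [seq (map_mpoly e af.1, map_mpoly e af.2) | af <- w'] = w.
  have : {subset unzip1 w ++ unzip2 w <= qs}.
    by move=> q qw; rewrite mem_cat qw orbT.
  elim: (w) => [|[a f] w0 IH] sub; first by exists [::].
  have [|w' <-] := IH.
    move=> q qw; apply: sub; rewrite /= inE mem_cat inE.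
    by move: qw; rewrite mem_cat => /orP[] ->; rewrite !orbT.
  have [|a' a'E] := lift a; first by apply: sub; rewrite inE eqxx.
  have [|f' f'E] := lift f.
    by apply: sub; rewrite /= inE mem_cat inE eqxx !orbT.
  by exists ((a', f') :: w') => /=; rewrite a'E f'E.
have : map_mpoly t (\sum_(af <- w') af.1 * (comp_mpoly lq af.2 - af.2)) =
    map_mpoly t 1.
  apply: (map_mpoly_ker ker); rewrite rmorph1 -w1 -w'E big_map rmorph_sum.
  by apply: eq_bigr => af _; rewrite rmorphM rmorphB /= es.
move/(congr1 (meval v)); rewrite !rmorph1 (raddf_sum (map_mpoly t)).
rewrite (raddf_sum (meval v)) big1 => [/esym/eqP|]; first by rewrite oner_eq0.
move=> af _ /=; rewrite (rmorphM (map_mpoly t)) rmorphM (rmorphB (map_mpoly t)).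
by rewrite rmorphB /= evs fix_v subrr mulr0.
Qed.

(** * Generalized eigenspaces *)

Section PolynomialAction.
Variables (k : fieldType) (V : lmodType k) (phi : V -> V).
Implicit Types (P Q : {poly k}) (f g : V) (a b : k).

Definition poly_act (P : {poly k}) (f : V) : V :=
  \sum_(i < size P) P`_i *: iter i phi f.

Lemma poly_act_widen P N f : (size P <= N)%N ->
  poly_act P f = \sum_(i < N) P`_i *: iter i phi f.
Proof.
move=> leN; rewrite /poly_act (big_ord_widen N (fun i => P`_i *: iter i phi f)) //.
rewrite big_mkcond; apply: eq_bigr => i _; case: ltnP => // le_i.
by rewrite nth_default // scale0r.
Qed.

Lemma poly_actD P Q f : poly_act (P + Q) f = poly_act P f + poly_act Q f.
Proof.
pose N := maxn (size P) (size Q).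
rewrite !(@poly_act_widen _ N) ?leq_maxl ?leq_maxr ?size_polyD //.
by rewrite -big_split; apply: eq_bigr => i _; rewrite coefD scalerDl.
Qed.

Lemma poly_actZ a P f : poly_act (a *: P) f = a *: poly_act P f.
Proof.
rewrite !(@poly_act_widen _ (size P)) ?size_scale_leq // scaler_sumr.
by apply: eq_bigr => i _; rewrite coefZ scalerA.
Qed.

Lemma poly_actMX P f : poly_act (P * 'X) f = poly_act P (phi f).
Proof.
rewrite (@poly_act_widen _ (size P).+1); last first.
  by apply: leq_trans (size_polyMleq _ _) _; rewrite size_polyX addn2.
rewrite big_ord_recl coefMX eqxx scale0r add0r; apply: eq_bigr => i _.
by rewrite coefMX /= -iterSr.
Qed.

Lemma poly_actC a f : poly_act a%:P f = a *: f.
Proof. by rewrite (@poly_act_widen _ 1) ?size_polyC ?leq_b1 // big_ord1 coefC. Qed.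

Hypothesis lphi : linear phi.

Lemma poly_act_linear P : linear (poly_act P).
Proof.
move=> a u v; rewrite scaler_sumr -big_split; apply: eq_bigr => i _ /=.
have -> : iter i phi (a *: u + v) = a *: iter i phi u + iter i phi v.
  by elim: (val i) => //= m ->; rewrite lphi.
by rewrite scalerDr !scalerA mulrC.
Qed.

Lemma poly_act_comm P f : phi (poly_act P f) = poly_act P (phi f).
Proof.
rewrite (linear_bigsum lphi); apply: eq_bigr => i _.
by rewrite (linear_scale lphi) -iterSr.
Qed.

Lemma poly_actM P Q f : poly_act (P * Q) f = poly_act P (poly_act Q f).
Proof.
elim/poly_ind: P f => [|P c IH] f.
  by rewrite mul0r -[0]/(0%:P) !poly_actC !scale0r.
rewrite mulrDl mulrAC -mulrA mulrA poly_actD poly_actMX IH.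
by rewrite mul_polyC poly_actZ poly_actD poly_actMX poly_actC poly_act_comm.
Qed.

Lemma poly_act_mulC P Q f :
  poly_act P (poly_act Q f) = poly_act Q (poly_act P f).
Proof. by rewrite -!poly_actM mulrC. Qed.

Lemma poly_actXsubC a f : poly_act ('X - a%:P) f = phi f - a *: f.
Proof.
by rewrite -(mul1r 'X) -polyCN poly_actD poly_actMX !poly_actC scale1r scaleNr.
Qed.

Lemma poly_actXn a N f : poly_act (('X - a%:P) ^+ N) f =
  iter N (fun g => phi g - a *: g) f.
Proof.
elim: N f => [|N IH] f; first by rewrite expr0 poly_actC scale1r.
by rewrite exprS poly_actM IH poly_actXsubC.
Qed.

Definition gen_eigen (a : k) (f : V) : Prop :=
  exists N, poly_act (('X - a%:P) ^+ N) f = 0.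

Lemma gen_eigen_widen a f : gen_eigen a f ->
  exists N, forall M, (N <= M)%N -> poly_act (('X - a%:P) ^+ M) f = 0.
Proof.
move=> [N f0]; exists N => M leNM; rewrite -(subnK leNM) exprD poly_actM f0.
exact: linear_zero (poly_act_linear _).
Qed.

Lemma gen_eigen_lin a b f g : gen_eigen a f -> gen_eigen a g ->
  gen_eigen a (b *: f + g).
Proof.
move=> /gen_eigen_widen[N fN] /gen_eigen_widen[M gM]; exists (maxn N M).
by rewrite poly_act_linear fN ?leq_maxl // gM ?leq_maxr // scaler0 addr0.
Qed.

Lemma gen_eigen0 a : gen_eigen a 0.
Proof. by exists 0%N; exact: linear_zero (poly_act_linear _). Qed.

Lemma gen_eigen_poly_act a P f : gen_eigen a f -> gen_eigen a (poly_act P f).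
Proof.
move=> [N f0]; exists N; rewrite poly_act_mulC f0.
exact: linear_zero (poly_act_linear _).
Qed.

Lemma gen_eigen_XsubC a f :
  gen_eigen a (poly_act ('X - a%:P) f) -> gen_eigen a f.
Proof. by case=> N f0; exists N.+1; rewrite exprSr poly_actM. Qed.

(** [X - b] is coprime to [(X - a)^N], so a Bezout coefficient inverts [phi - b] on [f]. *)
Lemma gen_eigen_divXsubC a b f : a != b -> gen_eigen a f ->
  exists2 g, gen_eigen a g & poly_act ('X - b%:P) g = f.
Proof.
move=> ab Ef; have [N f0] := Ef.
have /Bezout_eq1_coprimepP[[u v] /= uv] :
    coprimep ('X - b%:P) (('X - a%:P) ^+ N).
  by rewrite coprimep_expr // coprimep_XsubC2 // subr_eq0.
exists (poly_act u f); first exact: gen_eigen_poly_act.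
rewrite -poly_actM mulrC -[RHS]scale1r -poly_actC -[1%:P]uv poly_actD.
by rewrite [poly_act (v * _) f]poly_actM f0 (linear_zero (poly_act_linear _)) addr0.
Qed.

Definition gen_eigens (s : seq (k * V)) : Prop :=
  forall p, p \in s -> gen_eigen p.1 p.2.

Lemma gen_eigens_cons p s :
  gen_eigens (p :: s) <-> gen_eigen p.1 p.2 /\ gen_eigens s.
Proof.
split=> [E|[Ep Es] q]; last by rewrite inE => /predU1P[->|/Es].
by split=> [|q qs]; apply: E; rewrite inE ?eqxx ?qs ?orbT.
Qed.

(** Summands with eigenvalue other than [b] are divided exactly by [phi - b]; those with eigenvalue
    [b] make up the error term. *)
Lemma gen_eigens_div_sum b s : gen_eigens s ->
  exists2 s', gen_eigens s' &
    gen_eigen b (\sum_(p <- s) p.2 - poly_act ('X - b%:P) (\sum_(p <- s') p.2)).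
Proof.
have act0 P : poly_act P 0 = 0 by apply: linear_zero (poly_act_linear _).
elim: s => [|[a f] s IH] /=.
  by exists [::] => //; rewrite !big_nil act0 subrr; exact: gen_eigen0.
move=> /gen_eigens_cons[/= Ef /IH[s' Es' Eb]].
have [ab|ab] := eqVneq a b.
  exists s' => //; rewrite big_cons -addrA.
  rewrite -ab in Eb *; have := gen_eigen_lin 1 Ef Eb.
  by rewrite scale1r.
have [g Eg gE] := gen_eigen_divXsubC ab Ef.
exists ((a, g) :: s'); first by apply/gen_eigens_cons.
rewrite !big_cons /= (linear_add (poly_act_linear _)) gE opprD addrACA subrr.
by rewrite add0r.
Qed.

(** Primary decomposition by induction on the roots, repetitions allowed: [(phi - r) f] decomposes
    by induction, and subtracting from [f] the quotients of its summands by [phi - r] leaves a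
    generalized eigenvector for [r]. *)
Lemma gen_eigens_sum_prod (rs : seq k) f :
  poly_act (\prod_(r <- rs) ('X - r%:P)) f = 0 ->
  exists2 s, gen_eigens s & f = \sum_(p <- s) p.2.
Proof.
elim: rs f => [|r rs IH] f.
  rewrite big_nil poly_actC scale1r => ->.
  by exists [::] => //; rewrite big_nil.
rewrite big_cons mulrC poly_actM => /IH[s Es fE].
have [s' Es'] := gen_eigens_div_sum r Es.
rewrite -fE -(linear_sub (poly_act_linear _)) => /gen_eigen_XsubC Er.
exists ((r, f - \sum_(p <- s') p.2) :: s'); first exact/gen_eigens_cons.
by rewrite big_cons /= subrK.
Qed.

(** Chinese remainders, one root at a time: the correction term is a multiple of [P], so the earlier
    congruences persist, and [u * P] is 1 modulo the new factor. *)
Lemma poly_interpolation (c : k -> k) N (rs : seq k) :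
  exists Q, forall r, r \in rs -> ('X - r%:P) ^+ N %| Q - (c r)%:P.
Proof.
elim: rs => [|r rs [Q HQ]]; first by exists 0.
have [r_rs|r_rs] := boolP (r \in rs).
  by exists Q => r'; rewrite inE => /predU1P[->|]; exact: HQ.
pose P := \prod_(r' <- rs) ('X - r'%:P) ^+ N.
have dvdP r' : r' \in rs -> ('X - r'%:P) ^+ N %| P.
  by move=> r'_rs; rewrite /P (big_rem r') //= dvdp_mulr.
have /Bezout_eq1_coprimepP[[u v] /= uv] : coprimep P (('X - r%:P) ^+ N).
  rewrite /P; elim: (rs) r_rs => [|r' rs' IH].
    by rewrite big_nil coprime1p.
  rewrite inE negb_or => /andP[rr' /IH co]; rewrite big_cons coprimepMl co andbT.
  by rewrite coprimep_expl // coprimep_expr // coprimep_XsubC2 // subr_eq0.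
exists (Q + ((c r)%:P - Q) * (u * P)) => r'; rewrite inE => /predU1P[->|r'_rs].
  have -> : u * P = 1 - v * ('X - r%:P) ^+ N by rewrite -uv addrK.
  have -> : Q + ((c r)%:P - Q) * (1 - v * ('X - r%:P) ^+ N) - (c r)%:P =
      (Q - (c r)%:P) * v * ('X - r%:P) ^+ N by ring.
  exact: dvdp_mull.
by rewrite addrAC dvdp_add ?HQ // mulrA dvdp_mull ?dvdP.
Qed.

(** Independence of generalized eigenspaces: a single interpolating [Q] makes [Q(phi)] act on each
    summand as the scalar [c p.1], so the twisted sum is [Q(phi)] applied to 0. *)
Lemma gen_eigens_twist0 (c : k -> k) s : gen_eigens s ->
  \sum_(p <- s) p.2 = 0 -> \sum_(p <- s) c p.1 *: p.2 = 0.
Proof.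
move=> Es s0.
have [N NE] : exists N, forall M, (N <= M)%N -> forall p, p \in s ->
    poly_act (('X - p.1%:P) ^+ M) p.2 = 0.
  elim: s Es {s0} => [|p s IH]; first by exists 0%N.
  move=> /gen_eigens_cons[/gen_eigen_widen[N pN] /IH[M sM]].
  exists (maxn N M) => K; rewrite geq_max => /andP[leN leM] q.
  by rewrite inE => /predU1P[->|]; [exact: pN | exact: sM].
have [Q HQ] := poly_interpolation c N (unzip1 s).
have := congr1 (poly_act Q) s0.
rewrite (linear_bigsum (poly_act_linear Q)) (linear_zero (poly_act_linear Q)) => E.
rewrite -[RHS]E; apply: eq_big_seq => p ps.
have /dvdpP[W QE] := HQ p.1 (map_f _ ps).
rewrite -[Q](subrK (c p.1)%:P) QE poly_actD poly_actM NE //.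
by rewrite (linear_zero (poly_act_linear _)) add0r poly_actC.
Qed.

End PolynomialAction.

Lemma gen_eigens_sum (k : closedFieldType) (V : lmodType k) (phi : V -> V)
    (P : {poly k}) (f : V) :
  linear phi -> P != 0 -> poly_act phi P f = 0 ->
  exists s, [/\ gen_eigens phi s, forall p, p \in s -> p.2 != 0
    & f = \sum_(p <- s) p.2].
Proof.
move=> lphi P0; have [rs ->] := closed_field_poly_normal P.
rewrite poly_actZ => /eqP; rewrite scaler_eq0 lead_coef_eq0 (negPf P0) /= => /eqP.
move=> /(gen_eigens_sum_prod lphi)[s Es ->].
(* Dropping the zero summands makes every remaining scalar an actual eigenvalue. *)
exists [seq p <- s | p.2 != 0]; split=> [p|p|].
- by rewrite mem_filter => /andP[_ /Es].
- by rewrite mem_filter => /andP[].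
- rewrite big_filter [RHS]big_mkcond; apply: eq_bigr => p _.
  by case: eqP.
Qed.

Section MultiplicativeEigen.
Variables (k : fieldType) (A : comAlgType k) (phi : A -> A).
Hypotheses (lphi : linear phi) (phiM : GRing.monoid_morphism phi).

Lemma gen_eigen1 : gen_eigen phi 1 1.
Proof. by exists 1%N; rewrite poly_actXsubC phiM.1 scale1r subrr. Qed.

(** A twisted Leibniz rule: [(phi - ab)(fg) = a f (phi - b)g + (phi - a)f phi(g)]. Each term lowers
    one of the two nilpotency orders, so induction on their sum applies. *)
Lemma gen_eigenM a b f g : gen_eigen phi a f -> gen_eigen phi b g ->
  gen_eigen phi (a * b) (f * g).
Proof.
move=> [N fN] [M gM].
have [K leK] := ubnP (N + M); exists K.
elim: K N M f g fN gM leK => // K IH N M f g fN gM.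
rewrite ltnS => leK; rewrite exprSr poly_actM //.
have E : poly_act phi ('X - (a * b)%:P) (f * g) =
    a *: (f * poly_act phi ('X - b%:P) g) + poly_act phi ('X - a%:P) f * phi g.
  rewrite !poly_actXsubC // phiM.2 -scalerA mulrBr mulrBl scalerBr.
  by rewrite -scalerAr -scalerAl [RHS]addrC addrA subrK.
have act0 P : poly_act phi P 0 = 0 by apply: linear_zero (poly_act_linear _ _).
rewrite E (poly_act_linear lphi).
case: N fN leK => [|N] fN leK.
  move: fN; rewrite expr0 poly_actC scale1r => ->.
  by rewrite act0 !mul0r !act0 scaler0 addr0.
case: M gM leK => [|M] gM leK.
  move: gM; rewrite expr0 poly_actC scale1r => ->; rewrite (linear_zero lphi).
  by rewrite act0 !mulr0 !act0 scaler0 addr0.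
rewrite [X in a *: X](IH N.+1 M); first last.
- by move: leK; rewrite addnS.
- by rewrite -poly_actM // -exprSr.
- by [].
rewrite (IH N M.+1) ?scaler0 ?addr0 //.
- by rewrite -poly_actM // -exprSr.
- by rewrite -poly_act_comm // gM (linear_zero lphi).
Qed.

End MultiplicativeEigen.

(** * Characters of the group of eigenvalues *)

Section Characters.
Variable k : closedFieldType.
Hypothesis k0 : [pchar k] =i pred0.

(** For nonzero entries this is the multiplicative group generated by [ls], peeled one generator at
    a time so that characters can be extended by induction. *)
Fixpoint mul_span (ls : seq k) (x : k) : Prop :=
  if ls is l :: ls' then exists a : int, mul_span ls' (x * l ^ a) else x = 1.

Lemma mul_span1 ls : mul_span ls 1.
Proof. by elim: ls => //= l ls IH; exists 0; rewrite expr0z mulr1. Qed.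

Lemma mul_spanM ls x y : 0 \notin ls ->
  mul_span ls x -> mul_span ls y -> mul_span ls (x * y).
Proof.
elim: ls x y => [|l ls IH] x y /=; first by move=> _ -> ->; rewrite mulr1.
rewrite inE eq_sym negb_or => /andP[l0 ls0] [a xa] [b yb]; exists (a + b).
by rewrite expfzDr // mulrACA; apply: IH.
Qed.

Lemma mul_spanV ls x : mul_span ls x -> mul_span ls x^-1.
Proof.
elim: ls x => [|l ls IH] x /=; first by move=> ->; rewrite invr1.
by move=> [a xa]; exists (- a); rewrite -invr_expz -invfM; apply: IH.
Qed.

Lemma mul_span_mem ls x : 0 \notin ls -> x \in ls -> mul_span ls x.
Proof.
elim: ls => //= l ls IH; rewrite inE eq_sym negb_or => /andP[l0 ls0].
rewrite inE => /predU1P[->|xls].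
  by exists (-1); rewrite exprN1 divff //; exact: mul_span1.
by exists 0; rewrite expr0z mulr1; exact: IH.
Qed.

Lemma mul_spanX ls x (a : int) : 0 \notin ls -> mul_span ls x -> mul_span ls (x ^ a).
Proof.
move=> ls0 xs; have xn m : mul_span ls (x ^+ m).
  elim: m => [|m IH]; first by rewrite expr0; exact: mul_span1.
  by rewrite exprS; apply: mul_spanM.
by case: a => m; [exact: xn | apply: mul_spanV; exact: xn].
Qed.

(** Take a root of [1 + X + ... + X^(r-1)], whose value at 1 is [r]. *)
Lemma nontrivial_root_unity r : (1 < r)%N -> (r%:R : k) != 0 ->
  exists2 z : k, z ^+ r = 1 & z != 1.
Proof.
move=> r1 rn0; pose P := \poly_(i < r) (1 : k).
have [|z /rootP Pz] := closed_rootP P _.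
  by rewrite size_poly_eq ?oner_eq0 // gtn_eqF.
exists z.
  apply/eqP; rewrite -subr_eq0 subrX1 horner_poly in Pz *.
  by under eq_bigr => i _ do rewrite -[_ ^+ _]mul1r; rewrite Pz mulr0.
apply: contra_neq rn0 => z1; move: Pz; rewrite horner_poly z1 => <-.
by under [RHS]eq_bigr => i _ do rewrite expr1n mulr1; rewrite sumr_const card_ord.
Qed.

(* The exponents [a] with [l ^ a] in the span form a proper subgroup of Z. *)
Lemma prime_dvd_exponents ls l : 0 \notin ls -> l != 0 -> ~ mul_span ls l ->
  exists2 r, prime r & forall a : int, mul_span ls (l ^ a) -> (r %| `|a|)%N.
Proof.
move=> ls0 l0 lls.
have absM (a : int) : mul_span ls (l ^ a) -> mul_span ls (l ^+ `|a|).
  case: a => m //=; rewrite /exprz => /mul_spanV.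
  by rewrite invrK.
have [[d d_gt0 dls]|nd] := pselect (exists2 d, (0 < d)%N & mul_span ls (l ^+ d)).
  pose P d := (0 < d)%N && `[< mul_span ls (l ^+ d) >].
  have [|{d d_gt0 dls} d /andP[d_gt0 /asboolP dls] mind] := @ex_minnP P.
    by exists d; rewrite /P d_gt0; apply/asboolP.
  have d1 : d != 1%N by apply/eqP => d1; apply: lls; rewrite d1 in dls.
  exists (pdiv d); first by rewrite pdiv_prime // ltn_neqAle eq_sym d1.
  move=> a /absM als; apply: dvdn_trans (pdiv_dvd d) _.
  rewrite /dvdn -leqn0 leqNgt; apply/negP => m_gt0.
  have := mind (`|a| %% d)%N; rewrite leqNgt ltn_mod d_gt0 /P m_gt0 /= => /implyP.
  rewrite implybF => /negP[]; apply/asboolP.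
  have -> : l ^+ (`|a| %% d) = l ^+ `|a| * (l ^+ d) ^ (- (`|a| %/ d)%:Z).
    rewrite {2}(divn_eq `|a| d) exprD mulnC exprM -invr_expz -exprnP mulrAC.
    by rewrite divff ?mul1r // !expf_neq0.
  by apply: mul_spanM => //; apply: mul_spanX.
(* No positive power of [l] lies in the span, so only [a = 0] qualifies and any prime would do. *)
exists 2%N => // a /absM als.
have [->|a0] := posnP `|a|%N; first exact: dvdn0.
by case: nd; exists `|a|%N.
Qed.

(** If the head [l] lies in the span of the tail, the character of the tail is reused. Otherwise the
    new character is trivial on that span and sends [l] to a nontrivial [r]-th root of unity [z],
    where [r] divides every exponent putting a power of [l] in the span. *)
Lemma exists_character (ls : seq k) : 0 \notin ls -> has (predC1 1) ls ->
  exists (r : nat) (c : k -> k), [/\ prime r,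
    forall x y, mul_span ls x -> mul_span ls y -> c (x * y) = c x * c y,
    forall x, mul_span ls x -> c x ^+ r = 1
    & exists2 x, x \in ls & c x != 1].
Proof.
elim: ls => //= l ls IH; rewrite inE eq_sym negb_or => /andP[l0 ls0] nt.
have [lls|lls] := pselect (mul_span ls l).
  have [|r [c [pr_r cM cr [x xls cx]]]] := IH ls0.
    apply: contraTT nt => nls; rewrite negb_or nls andbT negbK; apply/eqP.
    have {nls} ls1 y : y \in ls -> y = 1.
      by move=> yls; apply/eqP; apply: contraNT nls => y1; apply/hasP; exists y.
    elim: (ls) ls1 lls => [|m ms IHms] ms1 //= [a].
    rewrite (ms1 m) ?inE ?eqxx // exp1rz mulr1; apply: IHms => y yms.
    by apply: ms1; rewrite inE yms orbT.
  have sub x' : (exists a : int, mul_span ls (x' * l ^ a)) -> mul_span ls x'.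
    move=> [a xa]; rewrite -[x'](mulfK (expfz_neq0 a l0)).
    by apply: mul_spanM => //; apply: mul_spanV; apply: mul_spanX.
  exists r, c; split=> //.
  - by move=> x' y' /sub xs /sub ys; apply: cM.
  - by move=> x' /sub /cr.
  - by exists x => //; rewrite inE xls orbT.
have [r pr_r rP] := prime_dvd_exponents ls0 l0 lls.
have [||z zr z1] := @nontrivial_root_unity r; first exact: prime_gt1.
  by rewrite ((pcharf0P k).1 k0) -lt0n prime_gt0.
have z0 : z != 0.
  by apply: contra_neq (oner_neq0 k) => z0; rewrite -zr z0 expr0n gtn_eqF ?prime_gt0.
have zz (a b : int) : (r %| `|a - b|)%N -> z ^ a = z ^ b.
  move=> rab; rewrite -[a](subrK b) expfzDr //.
  suff -> : z ^ (a - b) = 1 by rewrite mul1r.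
  case: (a - b) rab => m /= /dvdnP[q E].
    by rewrite E -exprnP mulnC exprM zr expr1n.
  by rewrite /exprz E mulnC exprM zr expr1n invr1.
(* Two exponents [a] with [x * l ^ a] in the span differ by a multiple of [r], so [z ^ (- a)]
   depends only on [x]. Outside the extended span the value 1 is arbitrary. *)
have /choice[c cE] x :
    exists y, forall a : int, mul_span ls (x * l ^ a) -> y = z ^ (- a).
  have [[a xa]|nx] := pselect (exists a : int, mul_span ls (x * l ^ a)).
    exists (z ^ (- a)) => b xb; apply: zz; apply: rP.
    have x0 : x != 0.
      apply/eqP => x0; move: xa; rewrite x0 mul0r => m0.
      have: forall y, mul_span ls y -> y != 0.
        elim: (ls) ls0 => [|m ms IHms] /=; first by move=> _ y ->; exact: oner_neq0.
        rewrite inE negb_or => /andP[m0' /IHms H] y [e /H].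
        by rewrite mulf_eq0 negb_or => /andP[].
      by move=> /(_ _ m0); rewrite eqxx.
    have := mul_spanM ls0 xb (mul_spanV xa).
    rewrite invfM mulrACA divff // mul1r invr_expz -expfzDr // opprK.
    by rewrite addrC.
  by exists 1 => a xa; case: nx; exists a.
exists r, c; split=> //.
- move=> x y [a xa] [b yb]; rewrite (cE _ _ xa) (cE _ _ yb) -expfzDr // -opprD.
  by apply: cE; rewrite expfzDr // mulrACA; apply: mul_spanM.
- by move=> x [a xa]; rewrite (cE _ _ xa) exprnP exprzAC -exprnP zr exp1rz.
- exists l; first by rewrite inE eqxx.
  rewrite (cE _ (-1)) ?opprK //.
  by rewrite exprN1 divff //; exact: mul_span1.
Qed.

End Characters.

(** * Automorphisms commuting with a simple derivation *)

Local Open Scope classical_set_scope.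
Local Open Scope ring_scope.

(** * Twisting the generalized eigenspaces by a character *)

Section Twist.
Variables (k : fieldType) (A : comAlgType k) (phi : A -> A).
Hypotheses (lphi : linear phi) (phiM : GRing.monoid_morphism phi).
Variables (L : k -> Prop) (c : k -> k).
Hypotheses (L1 : L 1) (LM : forall x y, L x -> L y -> L (x * y)).
Hypothesis cM : forall x y, L x -> L y -> c (x * y) = c x * c y.
Hypothesis c1 : c 1 = 1.

(* The map acting as [c a] on the generalized eigenspace of [a]; it is a relation
   because independence of the chosen decomposition is [twist_uniq]. *)
Definition twist (f g : A) : Prop := exists s : seq (k * A),
  [/\ gen_eigens phi s, forall p, p \in s -> L p.1,
    f = \sum_(p <- s) p.2 & g = \sum_(p <- s) c p.1 *: p.2].

Lemma twist_eigen a f : L a -> gen_eigen phi a f -> twist f (c a *: f).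
Proof.
move=> La Ef; exists [:: (a, f)]; split; rewrite ?big_seq1 //.
  by apply/gen_eigens_cons.
by move=> p; rewrite inE => /eqP->.
Qed.

Lemma twistD f g f' g' : twist f g -> twist f' g' -> twist (f + f') (g + g').
Proof.
move=> [s [Es Ls -> ->]] [t [Et Lt -> ->]]; exists (s ++ t).
split; rewrite ?big_cat // => p; rewrite mem_cat => /orP[].
- exact: Es.
- exact: Et.
- exact: Ls.
- exact: Lt.
Qed.

Lemma twistZ a f g : twist f g -> twist (a *: f) (a *: g).
Proof.
move=> [s [Es Ls -> ->]]; exists [seq (p.1, a *: p.2) | p <- s]; split.
- move=> _ /mapP[p ps ->] /=; rewrite -[_ *: _]addr0.
  by apply: gen_eigen_lin => //; [exact: Es | exact: gen_eigen0].
- by move=> _ /mapP[p /Ls ? ->].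
- by rewrite big_map scaler_sumr.
- rewrite big_map scaler_sumr; apply: eq_bigr => p _.
  by rewrite !scalerA mulrC.
Qed.

Lemma twistM f g f' g' : twist f g -> twist f' g' -> twist (f * f') (g * g').
Proof.
move=> [s [Es Ls -> ->]] [t [Et Lt -> ->]].
exists [seq (p.1 * q.1, p.2 * q.2) | p <- s, q <- t]; split.
- by move=> _ /allpairsP[[p q] [/= /Es Ep /Et Eq ->]]; apply: gen_eigenM.
- by move=> _ /allpairsP[[p q] [/= /Ls Lp /Lt Lq ->]]; apply: LM.
- rewrite big_allpairs_dep mulr_suml; apply: eq_bigr => p _.
  by rewrite mulr_sumr.
- rewrite big_allpairs_dep mulr_suml; apply: eq_big_seq => p ps.
  rewrite mulr_sumr; apply: eq_big_seq => q qt /=.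
  by rewrite -scalerAl -scalerAr scalerA cM; [ | exact: Ls | exact: Lt].
Qed.

Lemma twist1 : twist 1 1.
Proof.
by have := twist_eigen L1 (gen_eigen1 phiM); rewrite c1 scale1r.
Qed.

Lemma twist_uniq f g h : twist f g -> twist f h -> g = h.
Proof.
move=> Tg /(twistZ (-1)) /(twistD Tg).
rewrite !scaleN1r subrr => -[s [Es _ /esym s0 E]].
by apply/eqP; rewrite -subr_eq0 E (gen_eigens_twist0 lphi c Es s0).
Qed.

Lemma twist_comm (D : A -> A) f g : linear D -> (forall f, phi (D f) = D (phi f)) ->
  twist f g -> twist (D f) (D g).
Proof.
move=> lD phiD [s [Es Ls -> ->]]; exists [seq (p.1, D p.2) | p <- s]; split.
- move=> _ /mapP[p /Es[N pN] ->] /=; exists N.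
  rewrite -[RHS](linear_zero lD) -pN !poly_actXn //.
  by elim: N {pN} => //= N ->; rewrite phiD (linear_sub lD) (linear_scale lD).
- by move=> _ /mapP[p /Ls ? ->].
- by rewrite big_map (linear_bigsum lD).
- rewrite big_map (linear_bigsum lD); apply: eq_bigr => p _.
  by rewrite (linear_scale lD).
Qed.

End Twist.

(** * Simplicity forces all eigenvalues to be 1 *)

Section Unipotence.
Variables (k : closedFieldType) (n : nat).
Hypothesis k0 : [pchar k] =i pred0.

(** The ideal [I] generated by all [s f - f] is [D]-stable because [D (s f - f) = s (D f) - D f]. It
    cannot contain 1, so it is zero. *)
Lemma simple_derivation_endo (D s : mpoly n k -> mpoly n k) r :
  simple_derivation D -> prime r -> linear s -> GRing.monoid_morphism s ->
  iter r s =1 id -> (forall f, s (D f) = D (s f)) -> s =1 id.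
Proof.
move=> [[lD DM] simD] pr_r ls sM sr sD.
pose I : set (mpoly n k) := [set f | exists w : seq (mpoly n k * mpoly n k),
  f = \sum_(p <- w) p.1 * (s p.2 - p.2)].
have I0 : I 0 by exists [::]; rewrite big_nil.
have ID f g : I f -> I g -> I (f + g).
  by move=> [v ->] [w ->]; exists (v ++ w); rewrite big_cat.
have IM a f : I f -> I (a * f).
  move=> [w ->]; exists [seq (a * p.1, p.2) | p <- w].
  by rewrite big_map mulr_sumr; apply: eq_bigr => p _; rewrite mulrA.
have Igen f : I (s f - f) by exists [:: (1, f)]; rewrite big_seq1 mul1r.
have [||I_0|I_1] := simD I.
- by split.
- move=> _ [_ [w ->] <-]; rewrite (linear_bigsum lD).
  apply: (big_ind I) => // p _; rewrite DM (linear_sub lD) -sD.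
  by apply: ID; [exact: IM | apply: IM].
- by move=> f; have := Igen f; rewrite I_0 => /eqP; rewrite subr_eq0 => /eqP.
- have : I 1 by rewrite I_1.
  by move=> [w /esym /(prime_order_fixed_ideal k0 pr_r ls sM sr)].
Qed.

Lemma simple_derivation_gen_eigen1 (D phi : mpoly n k -> mpoly n k) :
  simple_derivation D -> linear phi -> GRing.monoid_morphism phi ->
  injective phi -> (forall f, phi (D f) = D (phi f)) ->
  (forall i, exists2 P : {poly k},
     P != 0 & poly_act phi P (mpolyX k (mnm1 i)) = 0) ->
  forall f, gen_eigen phi 1 f.
Proof.
move=> simD lphi phiM phiI phiD lfin.
have [[lD _] _] := simD.
have /choice[s sP] i : exists s, [/\ gen_eigens phi s,
    forall p, p \in s -> p.2 != 0 & mpolyX k (mnm1 i) = \sum_(p <- s) p.2].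
  by have [P P0 Pi] := lfin i; exact: gen_eigens_sum Pi.
(* The eigenvalues occurring in the variables suffice: since eigenvalues multiply along products,
   all of [k[x]] decomposes with eigenvalues in [mul_span ls]. *)
pose ls := flatten [seq unzip1 (s i) | i <- enum 'I_n].
have ls_s i p : p \in s i -> p.1 \in ls.
  move=> ps; apply/flattenP; exists (unzip1 (s i)); last exact: map_f.
  by apply: map_f; rewrite mem_enum.
have sub_ls l : l \in ls -> exists2 h, gen_eigen phi l h & h != 0.
  move=> /flattenP[_ /mapP[i _ ->]] /mapP[p ps ->].
  by have [Es nz _] := sP i; exists p.2; [exact: Es | exact: nz].
have ls0 : 0 \notin ls.
  apply/negP => /sub_ls[h [N hN] /eqP[]].
  move: hN; rewrite subr0; elim: N => [|N IH].
    by rewrite expr0 poly_actC scale1r.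
  rewrite exprSr poly_actMX -poly_act_comm // => E.
  by apply: IH; apply: phiI; rewrite E (linear_zero lphi).
have [nt|triv] := boolP (has (predC1 1) ls); last first.
  have E1C c : gen_eigen phi 1 (mpolyC n c).
    have := gen_eigen_lin lphi c (gen_eigen1 phiM) (gen_eigen0 lphi 1).
    by rewrite addr0 alg_mpolyC.
  elim/mpoly_alg_ind => [//|i|f g Ef Eg|f g Ef Eg].
  - have [Es _ ->] := sP i.
    have s1 p : p \in s i -> p.1 = 1.
      move=> ps; apply/eqP; apply: contraNT triv => p1.
      by apply/hasP; exists p.1 => //; exact: ls_s ps.
    elim: (s i) Es s1 => [|p t IH] Et t1.
      by rewrite big_nil; exact: gen_eigen0.
    move: Et => /gen_eigens_cons[Ep Et].
    rewrite big_cons -[p.2]scale1r; apply: gen_eigen_lin => //.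
      by rewrite -(t1 p) // inE eqxx.
    by apply: IH => // q qt; apply: t1; rewrite inE qt orbT.
  - by have := gen_eigen_lin lphi 1 Ef Eg; rewrite scale1r.
  - by have := gen_eigenM lphi phiM Ef Eg; rewrite mulr1.
have [r [c [pr_r cM cr [l l_ls cl]]]] := exists_character k0 ls0 nt.
have c1 : c 1 = 1.
  have c0 : c 1 != 0.
    apply: contra_neq (oner_neq0 k) => E; rewrite -(cr 1 (mul_span1 ls)) E.
    by rewrite expr0n gtn_eqF ?prime_gt0.
  apply: (mulfI c0); rewrite -cM ?mulr1 //; exact: mul_span1.
pose T := twist phi (mul_span ls) c.
have TM := twistM lphi phiM (fun x y => mul_spanM ls0 (x := x) (y := y)) cM.
have T1 : T 1 1 by apply: twist1 => //; exact: mul_span1.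
have /choice[sg sgP] f : exists g, T f g.
  elim/mpoly_alg_ind: f => [a|i|f g [f' Tf] [g' Tg]|f g [f' Tf] [g' Tg]].
  - exists (a *: 1); rewrite -alg_mpolyC; exact: twistZ.
  - have [Es _ ->] := sP i; exists (\sum_(p <- s i) c p.1 *: p.2).
    exists (s i); split=> // p ps.
    by apply: mul_span_mem => //; exact: ls_s ps.
  - by exists (f' + g'); exact: twistD.
  - by exists (f' * g'); exact: TM.
have sgE f g : T f g -> sg f = g by move=> Tfg; exact: (twist_uniq lphi (sgP f) Tfg).
(* Iterating the twist raises the character to the power [m]; at [m = r] all its values become 1. *)
have eig_pow t m : gen_eigens phi t -> (forall p, p \in t -> mul_span ls p.1) ->
    iter m sg (\sum_(p <- t) p.2) = \sum_(p <- t) c p.1 ^+ m *: p.2.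
  move=> Et Lt; elim: m => [|m IH] /=.
    by apply: eq_bigr => p _; rewrite scale1r.
  rewrite IH; apply: sgE; exists [seq (p.1, c p.1 ^+ m *: p.2) | p <- t]; split.
  - move=> _ /mapP[p /Et Ep ->] /=.
    by rewrite -[_ *: _]addr0; apply: gen_eigen_lin => //; exact: gen_eigen0.
  - by move=> _ /mapP[p /Lt ? ->].
  - by rewrite big_map.
  - by rewrite big_map; apply: eq_bigr => p _; rewrite scalerA exprS.
have sg_id : sg =1 id.
  apply: (simple_derivation_endo simD pr_r).
  - by move=> a f g; apply: sgE; exact: twistD (twistZ lphi a (sgP f)) (sgP g).
  - split=> [|f g]; apply: sgE; [exact: T1 | exact: TM (sgP f) (sgP g)].
  - move=> f; have [t [Et Lt -> _]] := sgP f; rewrite eig_pow //.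
    by apply: eq_big_seq => p pt; rewrite cr ?scale1r //; exact: Lt.
  - by move=> f; apply: sgE; exact: (twist_comm lphi lD phiD (sgP f)).
(* The twist multiplies the nonzero [h] by [c l], so being the identity contradicts [c l != 1]. *)
have [h Eh h0] := sub_ls l l_ls.
have /sgE : T h (c l *: h) by apply: twist_eigen => //; exact: mul_span_mem.
rewrite sg_id => /eqP; rewrite -subr_eq0 -[h in h - _]scale1r -scalerBl.
by rewrite scaler_eq0 (negPf h0) orbF subr_eq0 eq_sym (negPf cl).
Qed.

End Unipotence.

(** * The one-parameter group of a unipotent automorphism *)

Section PolynomialFunctions.
Variable k : fieldType.
Implicit Types u v : k -> k.

Definition polyfun u : Prop := exists P : {poly k}, forall t, u t = P.[t].

Lemma polyfun_cst a : polyfun (fun=> a).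
Proof. by exists a%:P => t; rewrite hornerC. Qed.

Lemma polyfun_id : polyfun id.
Proof. by exists 'X => t; rewrite hornerX. Qed.

Lemma polyfunD u v : polyfun u -> polyfun v -> polyfun (fun t => u t + v t).
Proof. by move=> [P HP] [Q HQ]; exists (P + Q) => t; rewrite hornerD HP HQ. Qed.

Lemma polyfunM u v : polyfun u -> polyfun v -> polyfun (fun t => u t * v t).
Proof. by move=> [P HP] [Q HQ]; exists (P * Q) => t; rewrite hornerM HP HQ. Qed.

Lemma polyfun_sum (I : Type) (s : seq I) (C : pred I) (F : I -> k -> k) :
  (forall i, polyfun (F i)) -> polyfun (fun t => \sum_(i <- s | C i) F i t).
Proof.
move=> HF; elim: s => [|i s IH].
  by under eq_fun do rewrite big_nil; exact: polyfun_cst.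
under eq_fun do rewrite big_cons; case: (C i) => //; exact: polyfunD.
Qed.

Lemma polyfun_prod (I : Type) (s : seq I) (C : pred I) (F : I -> k -> k) :
  (forall i, polyfun (F i)) -> polyfun (fun t => \prod_(i <- s | C i) F i t).
Proof.
move=> HF; elim: s => [|i s IH].
  by under eq_fun do rewrite big_nil; exact: polyfun_cst.
under eq_fun do rewrite big_cons; case: (C i) => //; exact: polyfunM.
Qed.

Lemma polyfunX u d : polyfun u -> polyfun (fun t => u t ^+ d).
Proof. by move=> [P HP]; exists (P ^+ d) => t; rewrite horner_exp HP. Qed.

Lemma polyfun_comp u v : polyfun u -> polyfun v -> polyfun (fun t => u (v t)).
Proof.
by move=> [P HP] [Q HQ]; exists (P \Po Q) => t; rewrite horner_comp HP HQ.
Qed.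

Lemma polyfun_meval N (P : mpoly N k) (F : 'I_N -> k -> k) :
  (forall i, polyfun (F i)) -> polyfun (fun t => meval (fun i => F i t) P).
Proof.
move=> HF; under eq_fun do rewrite mevalE.
apply: polyfun_sum => m; apply: polyfunM; first exact: polyfun_cst.
by apply: polyfun_prod => i; exact: polyfunX.
Qed.

Hypothesis k0 : [pchar k] =i pred0.

Lemma poly_nat_roots (P : {poly k}) : (forall m, P.[m%:R] = 0) -> P = 0.
Proof.
move=> Pm; apply/eqP; apply: contraT => Pn0.
pose rs : seq k := [seq m%:R | m <- iota 0 (size P)].
have := @max_poly_roots _ P rs Pn0; rewrite size_map size_iota ltnn; apply.
  by apply/allP => _ /mapP[m _ ->]; apply/rootP.
rewrite map_inj_uniq ?iota_uniq // => a b /eqP.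
wlog ab : a b / (a <= b)%N => [H|].
  by case: (leqP a b) => [/H//|/ltnW/H ba]; rewrite eq_sym => /ba.
rewrite eq_sym -subr_eq0 -natrB // ((pcharf0P k).1 k0) subn_eq0 => ba.
by apply/eqP; rewrite eqn_leq ab.
Qed.

(** The transfer principle for flows: identities known at natural times, where the flow is
    iteration, extend to all [t]. *)
Lemma polyfun_eq u v : polyfun u -> polyfun v ->
  (forall m, u m%:R = v m%:R) -> forall t, u t = v t.
Proof.
move=> [P HP] [Q HQ] uv t; rewrite HP HQ; apply/eqP.
rewrite -subr_eq0 -hornerN -hornerD (_ : P - Q = 0) ?horner0 //.
by apply: poly_nat_roots => m; rewrite hornerD hornerN -HP -HQ uv subrr.
Qed.

Definition fbinom (t : k) j := (\prod_(i < j) (t - i%:R)) / j`!%:R.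

Lemma polyfun_fbinom j : polyfun (fbinom^~ j).
Proof.
apply: polyfunM; last exact: polyfun_cst.
apply: polyfun_prod => i; apply: polyfunD; [exact: polyfun_id|exact: polyfun_cst].
Qed.

Lemma fbinom0 t : fbinom t 0 = 1.
Proof. by rewrite /fbinom big_ord0 mul1r fact0 invr1. Qed.

Lemma fbinom1 t : fbinom t 1 = t.
Proof. by rewrite /fbinom big_ord1 subr0 factS fact0 muln1 invr1 mulr1. Qed.

Lemma fbinom_nat m j : fbinom m%:R j = 'C(m, j)%:R.
Proof.
have fj : (j`!%:R : k) != 0 by rewrite ((pcharf0P k).1 k0) -lt0n fact_gt0.
apply: (mulIf fj); rewrite -natrM bin_ffact /fbinom divfK // {fj}.
elim: j => [|j IH]; first by rewrite big_ord0.
rewrite big_ord_recr IH ffactnSr natrM /=.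
case: (leqP j m) => [jm|mj]; first by rewrite natrB.
by rewrite ffact_small // !mul0r.
Qed.

End PolynomialFunctions.

(** * The powers of a locally unipotent endomorphism with exponents in the field *)

Section Flow.
Variables (k : fieldType) (n : nat) (phi : mpoly n k -> mpoly n k).
Hypothesis k0 : [pchar k] =i pred0.
Hypotheses (lphi : linear phi) (phiM : GRing.monoid_morphism phi).

Definition shift (f : mpoly n k) := phi f - f.

Hypothesis unip : forall f, exists m, iter m shift f = 0.

Lemma linear_iter_shift j : linear (iter j shift).
Proof.
elim: j => [|j IH] a f g //; rewrite !iterS IH /shift lphi.
by rewrite scalerBr opprD addrACA.
Qed.

(** The binomial series of [(1 + shift)^t], cut at some chosen order killing [f]; by [flow_widen]
    any larger bound gives the same sum. *)
Definition flow (t : k) (f : mpoly n k) : mpoly n k :=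
  \sum_(j < xget 0%N [set m | iter m shift f = 0]) fbinom t j *: iter j shift f.

Lemma flow_widen f : exists N, iter N shift f = 0 /\
  forall M t, (N <= M)%N -> flow t f = \sum_(j < M) fbinom t j *: iter j shift f.
Proof.
rewrite /flow; set N := xget _ _; exists N.
have N0 : iter N shift f = 0 by exact: (xgetPex 0%N (unip f)).
split=> // M t leN.
rewrite (big_ord_widen M (fun j => fbinom t j *: iter j shift f)) // big_mkcond.
apply: eq_bigr => j _; case: ltnP => // le_j.
rewrite -(subnK le_j) iterD N0 (linear_zero (linear_iter_shift _)).
by rewrite scaler0.
Qed.

Lemma flow_linear t : linear (flow t).
Proof.
move=> a f g; have [N [_ fN]] := flow_widen f; have [M [_ gM]] := flow_widen g.
have [K [_ hK]] := flow_widen (a *: f + g); pose m := maxn K (maxn N M).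
rewrite (fN m) ?(gM m) ?(hK m) ?leq_max ?leqnn ?orbT //.
rewrite scaler_sumr -big_split; apply: eq_bigr => j _ /=.
by rewrite linear_iter_shift scalerDr !scalerA mulrC.
Qed.

(** The binomial theorem for [X = 1 + (X - 1)] in [k[X]], acting through [poly_act]. *)
Lemma flow_nat m f : flow m%:R f = iter m phi f.
Proof.
have [N [_ fN]] := flow_widen f.
rewrite (fN (maxn N m.+1)) ?leq_maxl //.
have -> : iter m phi f = poly_act phi ('X ^+ m) f.
  elim: m f {fN} => [|m IH] f; first by rewrite expr0 poly_actC scale1r.
  by rewrite iterSr IH exprSr poly_actMX.
rewrite -['X](subrK 1) addrC exprDn.
rewrite (big_morph (fun P => poly_act phi P f) (fun P Q => poly_actD phi P Q f)
  (_ : poly_act phi 0 f = 0)); last by rewrite -[0]/(0%:P) poly_actC scale0r.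
rewrite (big_ord_widen (maxn N m.+1) (fun j =>
  poly_act phi (1 ^+ (m - j) * ('X - 1) ^+ j *+ 'C(m, j)) f)) ?leq_maxr //.
rewrite [RHS]big_mkcond; apply: eq_bigr => j _ /=; rewrite fbinom_nat //.
case: ltnP => [_|lt_m]; last by rewrite bin_small // scale0r.
rewrite expr1n mul1r -scaler_nat poly_actZ poly_actXn //; congr (_ *: _).
by apply: eq_iter => g; rewrite scale1r.
Qed.

Lemma polyfun_flow m f : polyfun (fun t => mcoeff m (flow t f)).
Proof.
have [N [_ fN]] := flow_widen f.
under eq_fun do rewrite (fN N) // raddf_sum.
apply: polyfun_sum => j; under eq_fun do rewrite /= mcoeffZ.
by apply: polyfunM; [exact: polyfun_fbinom | exact: polyfun_cst].
Qed.

Lemma flow1 t : flow t 1 = 1.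
Proof.
apply/mpolyP=> m; apply: (polyfun_eq k0 (polyfun_flow m 1) (polyfun_cst _)) => d.
rewrite flow_nat; congr mcoeff; elim: d => //= d ->; exact: phiM.1.
Qed.

Lemma flowM t f g : flow t (f * g) = flow t f * flow t g.
Proof.
apply/mpolyP=> m; move: t; apply: (polyfun_eq k0); first exact: polyfun_flow.
  under eq_fun do rewrite mcoeffM.
  by apply: polyfun_sum => ij; apply: polyfunM; exact: polyfun_flow.
by move=> d; rewrite !flow_nat; congr mcoeff; elim: d => //= d ->; rewrite phiM.2.
Qed.

Lemma flowD s t f : flow (s + t) f = flow s (flow t f).
Proof.
(* The number of terms does not depend on [b], so [flow a (flow b f)] is polynomial in [b]. The
   identity is then extended from natural numbers one variable at a time. *)
have flow_flow a : exists N, forall b,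
    flow a (flow b f) = \sum_(j < N) fbinom b j *: flow a (iter j shift f).
  have [N [_ fN]] := flow_widen f; exists N => b; rewrite (fN N) //.
  rewrite (linear_bigsum (flow_linear a)); apply: eq_bigr => j _.
  by rewrite (linear_scale (flow_linear a)).
apply/mpolyP=> m; move: s; apply: (polyfun_eq k0).
- apply: (polyfun_comp (polyfun_flow m f)); apply: polyfunD.
    exact: polyfun_id.
  exact: polyfun_cst.
- exact: polyfun_flow.
move=> d; move: t; apply: (polyfun_eq k0).
- apply: (polyfun_comp (polyfun_flow m f)); apply: polyfunD.
    exact: polyfun_cst.
  exact: polyfun_id.
- have [N HN] := flow_flow d%:R.
  under eq_fun do rewrite HN raddf_sum.
  apply: polyfun_sum => j; under eq_fun do rewrite /= mcoeffZ.
  by apply: polyfunM; [exact: polyfun_fbinom | exact: polyfun_cst].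
- by move=> e; rewrite -natrD !flow_nat iterD.
Qed.

Lemma flow0 f : flow 0 f = f.
Proof. by have := flow_nat 0 f. Qed.

Lemma flow_alg_aut t : is_alg_aut (flow t).
Proof.
split; first exact: flow_linear.
- by split=> [|f g]; [exact: flow1 | exact: flowM].
- by exists (flow (- t)) => f; rewrite -flowD ?addNr ?subrr flow0.
Qed.

(** Only the terms [j = 0] and [j = 1] survive [d] further shifts, which leaves an expression affine
    in [t] from which [t] can be recovered. *)
Lemma shift_flow d t f : iter d.+2 shift f = 0 ->
  iter d shift (flow t f) = iter d shift f + t *: iter d.+1 shift f.
Proof.
move=> d0; have [N [_ fN]] := flow_widen f.
rewrite (fN N.+2) ?(leq_trans (leqnSn N)) // (linear_bigsum (linear_iter_shift _)).
rewrite 2!big_ord_recl big1 ?addr0 => [|j _].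
  rewrite !(linear_scale (linear_iter_shift _)) fbinom0 fbinom1 scale1r.
  by rewrite [iter d.+1 _ _]iterSr.
rewrite (linear_scale (linear_iter_shift _)) -iterD.
have -> : (d + lift ord0 (lift ord0 j) = j + d.+2)%N.
  by rewrite /= /bump !leq0n !add1n !addnS addnC.
by rewrite iterD d0 (linear_zero (linear_iter_shift _)) scaler0.
Qed.

End Flow.

(** * Regular functions and closures *)

Section RegularFunctions.
Variables (k : fieldType) (n : nat).
Implicit Types (F G : polyAut k n -> k).

Definition regular F : Prop := forall p, exists P : mpoly #|Defs.coord n p| k,
  forall psi, Aut_le p psi -> F psi = meval (@coords k n p psi) P.

Lemma regular_ext F G : F =1 G -> regular G -> regular F.
Proof. by move=> /funext ->. Qed.

Lemma regular_cst a : regular (fun=> a).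
Proof. by move=> p; exists (mpolyC _ a) => psi _; rewrite mevalC. Qed.

Lemma regularD F G : regular F -> regular G -> regular (fun psi => F psi + G psi).
Proof.
move=> rF rG p; have [P HP] := rF p; have [Q HQ] := rG p; exists (P + Q) => psi psip.
by rewrite mevalD HP ?HQ.
Qed.

Lemma regularM F G : regular F -> regular G -> regular (fun psi => F psi * G psi).
Proof.
move=> rF rG p; have [P HP] := rF p; have [Q HQ] := rG p; exists (P * Q) => psi psip.
by rewrite mevalM HP ?HQ.
Qed.

Lemma regular_polyfun (u : k -> k) F : polyfun u -> regular F ->
  regular (fun psi => u (F psi)).
Proof.
move=> [P HP] rF; apply: regular_ext (fun psi => HP (F psi)) _ => {u HP}.
elim/poly_ind: P => [|P c IH].
  by apply: regular_ext (fun psi => horner0 (F psi)) _; exact: regular_cst.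
apply: regular_ext (fun psi => hornerMXaddC P c (F psi)) _.
by apply: regularD; [exact: regularM | exact: regular_cst].
Qed.

Lemma mcoeff_msize_le (f : mpoly n k) d m :
  (msize f <= d)%N -> (d <= mdeg m)%N -> mcoeff m f = 0.
Proof.
move=> lef lem; apply/eqP; rewrite mcoeff_eq0.
by apply: msize_mdeg_ge; exact: leq_trans lem.
Qed.

Lemma mpoly_msize_sum (f : mpoly n k) d : (msize f <= d)%N ->
  f = \sum_(m : bmultinom n d) mcoeff m f *: mpolyX k m.
Proof. exact: mpolywE. Qed.

(** On a piece of the filtration [psi x_i] is a combination of finitely many monomials whose
    coefficients are coordinates of [psi], so this is a linear form in them. *)
Lemma regular_mcoeff (chi : mpoly n k -> mpoly n k) i m : linear chi ->
  regular (fun psi => mcoeff m (chi (psi (mpolyX k (mnm1 i))))).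
Proof.
move=> lchi p.
pose c (mu : bmultinom n p.+1) : 'I_#|Defs.coord n p| :=
  enum_rank ((i, mu) : Defs.coord n p).
exists (\sum_mu mcoeff m (chi (mpolyX k (bmnm mu))) *: mpolyX k (mnm1 (c mu))).
move=> psi psip.
rewrite {1}(mpoly_msize_sum (psip i)) (linear_bigsum lchi) !raddf_sum.
apply: eq_bigr => mu _ /=; rewrite (linear_scale lchi) mcoeffZ mevalZ mevalXU.
by rewrite /coords enum_rankK mulrC.
Qed.

Lemma closed_regular_zeros (I : Type) (F : I -> polyAut k n -> k) :
  (forall i, regular (F i)) -> closed [set psi | forall i, F i psi = 0].
Proof.
move=> rF; apply/Defs.closedE => p.
exists [set P | exists i, forall psi, Aut_le p psi ->
  F i psi = meval (@coords k n p psi) P].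
apply/seteqP; split=> psi /= [].
  by move=> F0 psip; split=> // P [i <-].
move=> psip H; split=> // i; have [P HP] := rF i p.
by rewrite HP //; apply: H; exists i.
Qed.

End RegularFunctions.

Section Subgroups.
Variables (k : fieldType) (n : nat).
Implicit Types (phi psi : polyAut k n) (G : set (polyAut k n)).

Lemma subgroupP G : subgroup G <->
  G 1%g /\ forall phi psi, G phi -> G psi -> G (phi * psi^-1)%g.
Proof.
split=> [[/set_mem G1 GV]|[G1 GV]].
  by split=> // phi psi Gphi Gpsi; apply: set_mem; apply: GV; exact: mem_set.
by split=> [|phi psi]; [exact: mem_set | move=> /set_mem Gphi /set_mem Gpsi;
   apply: mem_set; exact: GV].
Qed.

Lemma subgroupX G phi m : subgroup G -> G phi -> G (phi ^+ m)%g.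
Proof.
move=> /subgroupP[G1 GV] Gphi.
have GM u v : G u -> G v -> G (u * v)%g.
  by move=> Gu Gv; rewrite -[v]invgK -[(v^-1)%g]mul1g; apply: (GV) => //; exact: GV.
by elim: m => [|m IH]; rewrite ?expg0 // expgS; exact: GM.
Qed.

Lemma polyAutX phi m f : (phi ^+ m)%g f = iter m phi f.
Proof. by elim: m f => [|m IH] f; rewrite ?expg0 // expgS /= -IH. Qed.

Lemma polyAut_eqX phi psi :
  (forall i, phi (mpolyX k (mnm1 i)) = psi (mpolyX k (mnm1 i))) -> phi = psi.
Proof.
move=> eqX; apply: polyAut_ext => f.
have [lphi Mphi _] := polyAutP phi; have [lpsi Mpsi _] := polyAutP psi.
rewrite (alg_endo_subst lphi Mphi) (alg_endo_subst lpsi Mpsi); congr comp_mpoly.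
by apply: eq_from_tnth => i; rewrite !tnth_mktuple eqX.
Qed.

(** The iterates lie in a space of dimension [N], so the first [N + 1] of them are dependent; a row
    [v] of the kernel of their coefficient matrix lists the coefficients of [P]. *)
Lemma bounded_orbit_annihilator (phi : mpoly n k -> mpoly n k) f d :
  (forall m, (msize (iter m phi f) <= d)%N) ->
  exists2 P : {poly k}, P != 0 & poly_act phi P f = 0.
Proof.
move=> bd; pose N := #|{: bmultinom n d}|.
pose M := \matrix_(i < N.+1, j < N) mcoeff (bmnm (enum_val j)) (iter i phi f).
have : kermx M != 0.
  rewrite kermx_eq0 /row_free; have := rank_leq_col M.
  by case: eqP => // ->; rewrite ltnn.
move=> /rowV0Pn[v /sub_kermxP vM v0]; exists (rVpoly v).
  by apply: contra_neq v0 => E; rewrite -[v]rVpolyK E linear0.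
rewrite (@poly_act_widen _ _ _ _ N.+1) ?size_poly //.
apply/mpolyP=> m; rewrite mcoeff0 raddf_sum /=.
have [ltm|lem] := ltnP (mdeg m) d; last first.
  by apply: big1 => i _; rewrite mcoeffZ (mcoeff_msize_le (bd i)) // mulr0.
have := congr1 (fun A : 'rV_N => A 0 (enum_rank (BMultinom ltm))) vM.
rewrite !mxE => E; rewrite -[RHS]E; apply: eq_bigr => i _.
by rewrite mcoeffZ coef_rVpoly_ord mxE enum_rankK.
Qed.

End Subgroups.

(** * The one-parameter group as a closed connected subgroup *)

Section FlowGroup.
Variables (k : fieldType) (n : nat) (phi : polyAut k n).
Hypothesis k0 : [pchar k] =i pred0.
Hypothesis unip : locally_unipotent phi.

Definition flow_aut (t : k) : polyAut k n :=
  let: And3 lphi phiM _ := polyAutP phi in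
  PolyAut (flow_alg_aut k0 lphi phiM unip t).

Lemma flow_autE t f : flow_aut t f = flow phi t f.
Proof. by rewrite /flow_aut; case: polyAutP. Qed.

Let lphi : linear phi. Proof. by have [] := polyAutP phi. Qed.

Lemma flow_aut_nat m : flow_aut m%:R = (phi ^+ m)%g.
Proof. by apply: polyAut_ext => f; rewrite flow_autE flow_nat // polyAutX. Qed.

Lemma flow_autD s t : flow_aut (s + t) = (flow_aut s * flow_aut t)%g.
Proof. by apply: polyAut_ext => f /=; rewrite !flow_autE flowD. Qed.

Lemma flow_autN t : flow_aut (- t) = (flow_aut t)^-1%g.
Proof.
apply: (mulgI (flow_aut t)); rewrite mulgV -flow_autD subrr.
by have := flow_aut_nat 0.
Qed.

Lemma subgroup_flow_aut : subgroup (range flow_aut).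
Proof.
apply/subgroupP; split; first by exists 0 => //; exact: (flow_aut_nat 0).
by move=> _ _ [s _ <-] [t _ <-]; exists (s - t) => //; rewrite flow_autD flow_autN.
Qed.

(** The coefficients in degree above [p] are polynomial in [t] and vanish at every natural
    number. *)
Lemma Aut_le_flow_aut p : (forall m, Aut_le p (phi ^+ m)%g) ->
  forall t, Aut_le p (flow_aut t).
Proof.
move=> bd t i; rewrite leqNgt; apply/negP => lt_p.
have [m mf ltm] : exists2 m,
    m \in msupp (flow_aut t (mpolyX k (mnm1 i))) & (p < mdeg m)%N.
  apply: contrapT => nm; move: lt_p; rewrite msizeE ltnNge => /negP[].
  apply/bigmax_leqP_seq => m mf _; rewrite leqNgt; apply/negP => lt.
  by apply: nm; exists m.
move: mf; rewrite mcoeff_msupp flow_autE => /eqP[].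
apply: (polyfun_eq k0 (polyfun_flow lphi unip m _) (polyfun_cst 0)) => d.
by rewrite -flow_autE flow_aut_nat (mcoeff_msize_le (bd d i)).
Qed.

(** The flow stays in one piece of the filtration, with coordinates polynomial in [t]. So the
    preimage of [C] in the affine line is everything or lies among the roots of one nonzero
    polynomial. *)
Lemma closed_flow_aut C : (exists p, forall m, Aut_le p (phi ^+ m)%g) -> closed C ->
  (forall t, C (flow_aut t)) \/
  exists2 P : {poly k}, P != 0 & forall t, C (flow_aut t) -> root P t.
Proof.
move=> [p bd] /Defs.closedE /(_ p)[S CS].
have polyP (Q : mpoly #|Defs.coord n p| k) :
    polyfun (fun t => meval (@coords k n p (flow_aut t)) Q).
  apply: polyfun_meval => j; rewrite /coords; case: (enum_val j) => i m.
  under eq_fun do rewrite flow_autE.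
  exact: polyfun_flow.
have CE t : C (flow_aut t) <->
    forall Q, S Q -> meval (@coords k n p (flow_aut t)) Q = 0.
  have leC := Aut_le_flow_aut bd t; split=> [Ct|HS].
    by have : (C `&` Aut_le p) (flow_aut t) by []; rewrite CS => -[].
  have : (C `&` Aut_le p) (flow_aut t) by rewrite CS; split.
  by case.
have [all|/existsNP[t /CE/existsNP[Q /not_implyP[SQ Qt]]]] :=
  pselect (forall t, C (flow_aut t)); first by left.
right; have [P HP] := polyP Q; exists P.
  by apply/eqP => P0; apply: Qt; rewrite HP P0 horner0.
by move=> s /CE/(_ Q SQ); rewrite HP => /rootP.
Qed.

Lemma closed_flow_aut_nat C : (exists p, forall m, Aut_le p (phi ^+ m)%g) ->
  closed C -> (forall m, C (phi ^+ m)%g) -> forall t, C (flow_aut t).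
Proof.
move=> bd /(closed_flow_aut bd)[//|[P /eqP P0 HP]] Cm; case: P0.
by apply: (poly_nat_roots k0) => m; apply/rootP/HP; rewrite flow_aut_nat.
Qed.

(** Irreducibility of the affine line: if a clopen part and its complement were both proper, all
    parameters would be roots of [P * Q], against characteristic 0. *)
Lemma connected_flow_aut : (exists p, forall m, Aut_le p (phi ^+ m)%g) ->
  connected (range flow_aut).
Proof.
move=> bd B [b Bb] [U oU BU] [C cC BC].
have [all|[P P0 HP]] := closed_flow_aut bd cC.
  by rewrite BC; apply/setIidPl => _ [t _ <-].
have [all|[Q Q0 HQ]] := closed_flow_aut bd (open_closedC oU).
  by move: Bb; rewrite BU => -[[t _ <-]] /all.
have /eqP[] : P * Q != 0 by rewrite mulf_neq0.
apply: (poly_nat_roots k0) => m; apply/rootP; rewrite rootM.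
have [Bm|nBm] := pselect (B (flow_aut m%:R)).
  by rewrite HP //; move: Bm; rewrite BC => -[].
by rewrite HQ ?orbT // => Um; apply: nBm; rewrite BU.
Qed.

(* On a nontrivial flow some linear function of the coordinates of [flow t]
   equals [t], so the flow is the set of fixed points of a regular retraction. *)
Lemma flow_aut_param : exists2 F : polyAut k n -> k, regular F &
  forall t, flow_aut (F (flow_aut t)) = flow_aut t.
Proof.
have [fixX|/existsNP[i /eqP nfix]] :=
  pselect (forall i, phi (mpolyX k (mnm1 i)) = mpolyX k (mnm1 i)).
  exists (fun=> 0); first exact: regular_cst.
  have phi1 : phi = 1%g by apply: polyAut_eqX => i; rewrite fixX.
  have triv t : flow_aut t = 1%g.
    apply: polyAut_eqX => i; rewrite flow_autE; apply/mpolyP=> m.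
    apply: (polyfun_eq k0 (polyfun_flow lphi unip m _) (polyfun_cst _)) => d.
    by rewrite -flow_autE flow_aut_nat phi1 expg1n.
  by move=> t; rewrite !triv.
pose x := mpolyX k (mnm1 i).
have [d0 d0P] : exists d, iter d (shift phi) x = 0 by exact: unip.
have exd : exists d, iter d (shift phi) x == 0 by exists d0; apply/eqP.
case: (ex_minnP exd) => d /eqP dx mind.
(* Least order 0 or 1 would make [x] fixed by [phi], so it is at least 2 and [shift_flow]
   applies. *)
case: d dx mind => [|[|d]] dx mind.
- by move: nfix; rewrite -/x; move: dx => /= ->; rewrite (linear_zero lphi) eqxx.
- by move: nfix dx; rewrite /= /shift -subr_eq0 => /eqP.
have u0 : iter d.+1 (shift phi) x != 0 by apply/negP => /mind; rewrite ltnn.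
have [m um] : exists m, mcoeff m (iter d.+1 (shift phi) x) != 0.
  apply: contrapT => nm; case/eqP: u0; apply/mpolyP => m; rewrite mcoeff0.
  by apply/eqP; apply: contrapT => /negP ?; apply: nm; exists m.
(* This is [shift_flow] read at the monomial [m] and solved for [t]. *)
exists (fun psi => (mcoeff m (iter d (shift phi) (psi x)) -
    mcoeff m (iter d (shift phi) x)) / mcoeff m (iter d.+1 (shift phi) x)).
  apply: regularM; last exact: regular_cst.
  apply: regularD; last exact: regular_cst.
  exact/regular_mcoeff/linear_iter_shift.
move=> t; rewrite flow_autE shift_flow // mcoeffD mcoeffZ addrAC subrr add0r.
by rewrite mulfK.
Qed.

Lemma closed_range_flow_aut : closed (range flow_aut).
Proof.
have [F rF FE] := flow_aut_param.
rewrite (_ : range _ = [set psi : polyAut k n | forall im : 'I_n * multinom n,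
  mcoeff im.2 (psi (mpolyX k (mnm1 im.1))) -
  mcoeff im.2 (flow phi (F psi) (mpolyX k (mnm1 im.1))) = 0]).
  apply: closed_regular_zeros => -[i m] /=; apply: regularD.
    exact: (@regular_mcoeff _ _ id).
  under eq_fun do rewrite -mulN1r.
  apply: regularM; first exact: regular_cst.
  apply: (@regular_polyfun _ _
    (fun t => mcoeff m (flow phi t (mpolyX k (mnm1 i))))) => //.
  exact: polyfun_flow.
apply/seteqP; split=> [_ [t _ <-] im|psi H].
  by rewrite -flow_autE FE subrr.
exists (F psi) => //; apply: polyAut_eqX => i; rewrite flow_autE; apply/mpolyP=> m.
by have /eqP := H (i, m); rewrite subr_eq0 => /eqP.
Qed.

Lemma generated_sub G : subgroup G -> G phi -> Defs.generated phi `<=` G.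
Proof. by move=> sG Gphi; apply: smallest_sub => // _ ->. Qed.

Lemma generatedX m : Defs.generated phi (phi ^+ m)%g.
Proof. by move=> G [sG Gphi]; apply: subgroupX => //; exact: Gphi. Qed.

Lemma closure_generated : (exists p, forall m, Aut_le p (phi ^+ m)%g) ->
  closure (Defs.generated phi) = range flow_aut.
Proof.
move=> bd; apply/seteqP; split.
  rewrite closureE; apply: smallest_sub; first exact: closed_range_flow_aut.
  apply: generated_sub; first exact: subgroup_flow_aut.
  by exists 1%:R => //; rewrite flow_aut_nat expg1.
move=> _ [t _ <-]; apply: closed_flow_aut_nat => //; first exact: closed_closure.
by move=> m; apply: subset_closure; exact: generatedX.
Qed.

Lemma locally_unipotent_algebraic : (exists p, forall m, Aut_le p (phi ^+ m)%g) ->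
  algebraic phi.
Proof.
move=> bd; rewrite /algebraic closure_generated //; split.
- exact: subgroup_flow_aut.
- exact: closed_range_flow_aut.
- by case: bd => p bd; exists p => _ [t _ <-]; exact: Aut_le_flow_aut.
Qed.

End FlowGroup.

(** Bounded degree of the powers is what an algebraic automorphism and a member of an algebraic
    subgroup share; it makes each variable annihilated by a nonzero polynomial in [phi]. *)
Lemma AutD_bounded_unipotent (k : closedFieldType) (hk : [pchar k] =i pred0) n
    (D : mpoly n k -> mpoly n k) (hD : simple_derivation D) (phi : polyAut k n) :
  AutD D phi -> (exists p, forall m, Aut_le p (phi ^+ m)%g) ->
  locally_unipotent phi.
Proof.
move=> phiD [p bd] f; have [lphi phiM bphi] := polyAutP phi.
have [|i|N fN] := simple_derivation_gen_eigen1 hk hD lphi phiM (bij_inj bphi) _ _ f.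
- by move=> g; exact: (congr1 (fun h => h g) phiD).
- apply: (@bounded_orbit_annihilator _ _ _ _ p.+1) => m.
  by rewrite -polyAutX; exact: bd.
- exists N; rewrite -[RHS]fN poly_actXn //.
  by apply: eq_iter => g; rewrite scale1r.
Qed.

Theorem theorem3p4 (k : closedFieldType) (hk : [pchar k] =i pred0) (n : nat)
    (D : mpoly n k -> mpoly n k) (hD : simple_derivation D) :
  (forall phi : polyAut k n, AutD D phi -> algebraic phi -> unipotent phi) /\
  (forall G : set (polyAut k n), G `<=` AutD D -> algebraic_subgroup G ->
     unipotent_subgroup G /\ closed_connected_subgroup_of G (AutD0 D)).
Proof.
split=> [phi phiD alg|G GD [sG cG [p Gp]]].
  split=> //; apply: (AutD_bounded_unipotent hk hD phiD).
  have [_ _ [p gp]] := alg; exists p => m; apply: gp.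
  by apply: subset_closure; exact: generatedX.
have bd phi : G phi -> exists p, forall m, Aut_le p (phi ^+ m)%g.
  by move=> Gphi; exists p => m; apply: Gp; exact: subgroupX.
have unip phi : G phi -> locally_unipotent phi.
  by move=> Gphi; apply: (AutD_bounded_unipotent hk hD (GD _ Gphi)); exact: bd.
have G1 : G 1%g by have /subgroupP[] := sG.
have conG : connected G.
  (* Each member of [G] lies on its own flow, a connected subset of [G] through the identity, so [G]
     is a union of connected sets with a common point. *)
  rewrite (_ : G = \bigcup_(A in [set A | [/\ A 1%g, A `<=` G & connected A]]) A).
    apply: bigcup_connected; last by move=> A [].
    by exists 1%g => A [].
  apply/seteqP; split=> [phi Gphi|phi [A [_ AG _] Aphi]]; last exact: AG.
  exists (range (flow_aut hk (unip _ Gphi))); last first.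
    by exists 1%:R => //; rewrite flow_aut_nat expg1.
  split.
  - by have /subgroupP[] := subgroup_flow_aut hk (unip _ Gphi).
  - move=> _ [t _ <-]; apply: closed_flow_aut_nat => //; first exact: bd.
    by move=> m; exact: subgroupX.
  - exact/connected_flow_aut/bd.
have GD0 : G `<=` AutD0 D by exact: connected_component_max.
split.
  split; first by split=> //; exists p.
  move=> phi Gphi; split; last exact: unip.
  by apply: (locally_unipotent_algebraic hk); [exact: unip | exact: bd].
split=> //; exists G => //; exact/esym/setIidPl.
Qed.
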